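(* Let $\mathbb{F},q,\varpi,\mathbb{L},\theta,n,\pi,\varphi_0,\varphi_{new},\mathbb{E},D,\chi$ and the pairing $\{\cdot,\cdot\}$ be as in the context; in particular $\mathbb{E}\simeq\mathbb{L}$ is ramified over $\mathbb{F}$, $c(\theta)=2n$, $\theta|_{\mathbb{F}^\times}=w_\pi=1$, $c(\pi_\chi)\le c(\pi)$ and $\epsilon(\pi_{\mathbb{E}}\times\chi)=1$. Put $\widetilde{\varphi_{new}}=\pi\left(\begin{pmatrix}\varpi^{n}&0\\0&1\end{pmatrix}\right)\varphi_{new}$ and, for $x\in(\mathcal{O}_{\mathbb{F}}/\varpi^{\lceil n/2\rceil}\mathcal{O}_{\mathbb{F}})^\times$, $\varphi_x=\pi\left(\begin{pmatrix}x&0\\0&1\end{pmatrix}\right)\varphi_0$. Suppose that $\{\varphi_x,\varphi_x\}\neq0$ for a single $x\in(\mathcal{O}_{\mathbb{F}}/\varpi^{\lceil n/2\rceil}\mathcal{O}_{\mathbb{F}})^\times$. Then all off-diagonal terms $\{\varphi_y,\varphi_{y'}\}$, $y\ne y'$ in $(\mathcal{O}_{\mathbb{F}}/\varpi^{\lceil n/2\rceil}\mathcal{O}_{\mathbb{F}})^\times$, vanish, and $$\{\widetilde{\varphi_{new}},\widetilde{\varphi_{new}}\}=\frac{1}{(q-1)q^{\lceil n/2\rceil-1}}\{\varphi_x,\varphi_x\}.$$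
   Context: $\mathbb{F}$ is a $p$-adic field with $p\ne2$, residue field of order $q$, uniformizer $\varpi$, ring of integers $\mathcal{O}_{\mathbb{F}}$, valuation $v_{\mathbb{F}}$; $\psi$ is an additive character of $\mathbb{F}$ trivial on $\mathcal{O}_{\mathbb{F}}$ but not on $\varpi^{-1}\mathcal{O}_{\mathbb{F}}$. For a quadratic extension $\mathbb{L}/\mathbb{F}$ put $\psi_{\mathbb{L}}=\psi\circ\mathrm{Tr}_{\mathbb{L}/\mathbb{F}}$ and $U_{\mathbb{L}}(m)=1+\varpi_{\mathbb{L}}^m\mathcal{O}_{\mathbb{L}}$ ($m\ge 1$). For a multiplicative character $\nu$, $c(\nu)$ is its conductor exponent; $c(\pi)$ is the conductor exponent of $\pi$. The representation $\pi$. $\mathbb{L}/\mathbb{F}$ is a ramified quadratic extension and $\theta$ a character of $\mathbb{L}^\times$ with $\theta|_{\mathbb{F}^\times}=1$ and $c(\theta)=2n\ge2$. Let $\alpha_\theta\in\mathbb{L}^\times$ (chosen of trace $0$ to $\mathbb{F}$) satisfy $\theta(1+u)=\psi_{\mathbb{L}}(\alpha_\theta u)$ for all $u\in\varpi_{\mathbb{L}}^{n}\mathcal{O}_{\mathbb{L}}$. Put $D'=\alpha_\theta^{-2}\varpi^{-2n}\in\mathbb{F}$ (so $v_{\mathbb{F}}(D')=1$), identify $\sqrt{D'}$ with $\alpha_\theta^{-1}\varpi^{-n}$, and embed $\mathbb{L}=\mathbb{F}(\sqrt{D'})$ in $M_2(\mathbb{F})$ by $x+y\sqrt{D'}\mapsto\begin{pmatrix}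 x & y \\ y D' & x \end{pmatrix}$. Let $$K(n)=1+\begin{pmatrix}\varpi^{\lceil n/2\rceil}\mathcal{O}_{\mathbb{F}}&\varpi^{\lfloor n/2\rfloor}\mathcal{O}_{\mathbb{F}}\\ \varpi^{\lfloor n/2\rfloor+1}\mathcal{O}_{\mathbb{F}}&\varpi^{\lceil n/2\rceil}\mathcal{O}_{\mathbb{F}}\end{pmatrix},\qquad J=\mathbb{L}^\times K(n),$$ and let $\tilde\theta$ be the character of $J$ given by $\tilde\theta(l(1+x))=\theta(l)\psi(\mathrm{Tr}(\alpha_\theta x))$ for $l\in\mathbb{L}^\times$, $1+x\in K(n)$. Then $\pi=c\text{-}\mathrm{Ind}_J^{\mathrm{GL}_2(\mathbb{F})}\tilde\theta$, a supercuspidal representation with trivial central character $w_\pi$ and $c(\pi)=2n+1$, with invariant Hermitian inner product $(\cdot,\cdot)$. The minimal vector $\varphi_0\in\pi$ is the vector, unique up to scalar, on which $J$ acts by $\tilde\theta$; $\varphi_{new}$ is the newform of $\pi$ (the vector, unique up to scalar, fixed by matrices in $\mathrm{GL}_2(\mathcal{O}_{\mathbb{F}})$ with bottom row $\equiv(0,1)\bmod\varpi^{c(\pi)}$). Both are normalized to have norm $1$. The vector $\varphi_x$ depends only on $x\bmod\varpi^{\lceil n/2\rceil}$. The period. $\mathbb{E}\simeq\mathbb{L}$, written $\mathbb{E}=\mathbb{F}(\sqrt{D})$ with $v_{\mathbb{F}}(D)=1$, is embedded in $M_2(\mathbb{F})$ by $x+y\sqrt{D}\mapsto\begin{pmatrix}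 x & y \\ y D & x \end{pmatrix}$. $\chi$ is a character of $\mathbb{E}^\times$ with $\chi|_{\mathbb{F}^\times}=1$; $\pi_\chi$ is the representation of $\mathrm{GL}_2(\mathbb{F})$ associated to $\chi$ (via local Langlands applied to $\mathrm{Ind}_{\mathbb{E}}^{\mathbb{F}}\chi$), and it is assumed that $c(\pi_\chi)\le c(\pi)$. $\pi_{\mathbb{E}}$ is the base change of $\pi$ to $\mathbb{E}$; it is assumed that $\epsilon(\pi_{\mathbb{E}}\times\chi)=1$, so that $\mathrm{Hom}_{\mathbb{E}^\times}(\pi,\chi^{-1})\ne0$. For $\varphi,\varphi'\in\pi$, $$\{\varphi,\varphi'\}=\int_{\mathbb{F}^\times\backslash\mathbb{E}^\times}(\pi(t)\varphi,\varphi')\chi(t)\,dt,$$ with Haar measure such that $\mathrm{Vol}(\mathcal{O}_{\mathbb{F}}^\times\backslash\mathcal{O}_{\mathbb{E}}^\times)=1$. *)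

(* Defs.v *)
From HB Require Import structures.
From mathcomp Require Export all_boot all_order all_algebra all_field.
From mathcomp Require Export all_classical all_reals all_analysis.
From mathcomp.real_closed Require Export complex.

Set Implicit Arguments.
Unset Strict Implicit.
Unset Printing Implicit Defensive.

Import Order.TTheory GRing.Theory Num.Theory.
Local Open Scope classical_set_scope.
Local Open Scope ring_scope.

(** * Discretely valued fields *)

Section Valuation.
Variables (K : fieldType) (v : K -> int).

(* [x \in varpi^k O]; the value of [v] at [0] is never used. *)
Definition vge (k : int) (x : K) : bool := (x == 0) || (k <= v x).

Definition is_unit (x : K) : bool := (x != 0) && (v x == 0).

Definition normalized_valuation : Prop :=
  [/\ forall x y, x != 0 -> y != 0 -> v (x * y) = v x + v y,
      forall k x y, vge k x -> vge k y -> vge k (x + y)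
    & exists2 x, x != 0 & v x = 1].

Definition valuation_complete : Prop :=
  forall u : nat -> K,
    (forall k : int, exists N : nat, forall i j : nat,
       (N <= i)%N -> (N <= j)%N -> vge k (u i - u j)) ->
    exists l : K, forall k : int, exists N : nat, forall i : nat,
      (N <= i)%N -> vge k (u i - l).

Definition transversal (A : pred K) (r : rel K) (s : seq K) : Prop :=
  [/\ {subset s <= A},
      pairwise (fun x y => ~~ r x y) s
    & forall x, x \in A -> has (r x) s].

(* Complete discretely valued field of characteristic 0 with finite residue
   field of order [q] and residue characteristic [p]. *)
Definition padic_field (p q : nat) : Prop :=
  [/\ normalized_valuation,
      valuation_complete,
      [pchar K] =i pred0,
      prime p /\ vge 1 p%:R
    & exists2 s : seq K,
        transversal (vge 0) (fun x y => vge 1 (x - y)) s & size s = q].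

End Valuation.

(** * Additive and multiplicative characters *)

Section Characters.
Variables (C : numClosedFieldType) (K : fieldType) (v : K -> int) (q : nat).

Definition trivial_on_ideal (psi : K -> C) (m : int) : Prop :=
  forall x, vge v m x -> psi x = 1.

Definition additive_character (psi : K -> C) : Prop :=
  [/\ psi 0 = 1,
      forall x y, psi (x + y) = psi x * psi y
    & exists m, trivial_on_ideal psi m].

(* The largest [m] such that [psi] is trivial on [varpi^-m O]. *)
Definition level (psi : K -> C) : int :=
  xget 0 [set m | trivial_on_ideal psi (- m) /\
                  ~ trivial_on_ideal psi (- m - 1)].

(* Triviality on [U(m) = 1 + varpi^m O] for [m >= 1], on [U(0) = O^*] for
   [m = 0]. *)
Definition trivial_on_units (nu : K -> C) (m : nat) : Prop :=
  forall x, is_unit v x -> vge v m (x - 1) -> nu x = 1.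

(* Quasi-characters of [K^*]; the value at [0] is never used. *)
Definition mult_character (nu : K -> C) : Prop :=
  [/\ forall x, x != 0 -> nu x != 0,
      forall x y, x != 0 -> y != 0 -> nu (x * y) = nu x * nu y
    & exists m, trivial_on_units nu m].

Definition conductor (nu : K -> C) : nat :=
  xget 0%N [set c | trivial_on_units nu c /\
                    forall m, trivial_on_units nu m -> (c <= m)%N].

(* Tate's root number [epsilon(1/2, nu, psi)] for the self-dual measure: with
   [a = c(nu)] and [v(c) = a + level psi], the integral of [nu^-1 psi] over
   [c^-1 O^*] is a sum over [O^* / U(a)].  For [a = 0] the formula reads
   [nu(c)], the value for an unramified [nu]. *)
Definition epsilon (psi nu : K -> C) : C :=
  xget 0 [set e | exists (c : K) (s : seq K),
    [/\ c != 0,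
        v c = (conductor nu)%:Z + level psi,
        transversal (is_unit v)
          (fun x y => vge v (conductor nu) (x - y)) s
      & e = (sqrtC q%:R ^+ conductor nu)^-1 *
            \sum_(u <- s) (nu (u / c))^-1 * psi (u / c)]].

(* [beta] such that [L(s, nu)^-1 = 1 - beta q^-(s - 1/2)]. *)
Definition L_coef (nu : K -> C) : C :=
  xget 0 [set b | exists2 w : K, w != 0 /\ v w = 1 &
    b = if conductor nu == 0%N then nu w / sqrtC q%:R else 0].

(* Integral of a locally constant [f] over the shell [v(a) = k], for the Haar
   measure of [K^*] giving [O^*] volume 1. *)
Definition shell_integral (f : K -> C) (k : int) : C :=
  xget 0 [set z | exists (m : nat) (s : seq K),
    [/\ (0 < m)%N,
        forall a u, a != 0 -> v a = k -> vge v m (u - 1) -> f (a * u) = f a,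
        transversal (fun a => (a != 0) && (v a == k))
          (fun a b => vge v m (a / b - 1)) s
      & z = (\sum_(a <- s) f a) / (size s)%:R]].

End Characters.

(** * Ramified quadratic extensions *)

Section Quadratic.
Variables (C : numClosedFieldType) (F : fieldType) (v : F -> int) (q : nat).
Variables (E : fieldExtType F) (vE : E -> int).

Definition ramified_quadratic : Prop :=
  [/\ (\dim {:E} = 2)%N,
      normalized_valuation vE
    & forall a : F, a != 0 -> vE a%:A = v a *+ 2].

Definition mult_matrix (x : E) : 'M[F]_(\dim {:E}) :=
  passmx.mxof (vbasis {:E}) (vbasis {:E}) (amulr x).
Definition trE (x : E) : F := \tr (mult_matrix x).
Definition normE (x : E) : F := \det (mult_matrix x).

Definition psi_ext (psi : F -> C) (x : E) : C := psi (trE x).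

Definition quadratic_character (a : F) : C :=
  if `[< exists x : E, normE x = a >] then 1 else -1.

(* Langlands constant [epsilon(Ind 1_E, psi) / epsilon(1_E, psi_E)], where
   [Ind 1_E] is the sum of [1] and the quadratic character.  The residue fields
   of [E] and [F] have the same order [q]. *)
Definition lambda_factor (psi : F -> C) : C :=
  epsilon v q psi (fun=> 1) * epsilon v q psi quadratic_character /
  epsilon vE q (psi_ext psi) (fun=> 1).

End Quadratic.

(** * Representations of GL_2(F) *)

(* [mx22 a b c d] has rows [(a, b)] and [(c, d)]. *)
Definition mx22 (F : fieldType) (a b c d : F) : 'M[F]_2 :=
  \matrix_(i, j) if i == 0 then (if j == 0 then a else b)
                 else (if j == 0 then c else d).

(* A group action on the subspace [car] of [mod]; [act g w] is meaningful only
   for [g \in unitmx] and [w] in [car]. *)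
Record gl2rep (C : numClosedFieldType) (F : fieldType) := GL2Rep {
  rmod :> lmodType C;
  car : set rmod;
  act : 'M[F]_2 -> rmod -> rmod }.
Arguments car {C F} g _.
Arguments act {C F g} _ _.

Section GL2.
Variables (C : numClosedFieldType) (F : fieldType) (v : F -> int) (q : nat).
Implicit Types (pi : gl2rep C F) (g h : 'M[F]_2).

Definition is_subspace (V : lmodType C) (S : set V) : Prop :=
  S 0 /\ forall (a : C) x y, S x -> S y -> S (a *: x + y).

Definition stable pi (S : set pi) : Prop :=
  forall g x, g \in unitmx -> S x -> S (act g x).

Definition smooth_rep pi : Prop :=
  [/\ is_subspace (car pi) /\ stable (car pi),
      forall g (a : C) x y, g \in unitmx -> car pi x -> car pi y ->
        act g (a *: x + y) = a *: act g x + act g y,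
      forall x, car pi x -> act 1%:M x = x,
      forall g h x, g \in unitmx -> h \in unitmx -> car pi x ->
        act (g *m h) x = act g (act h x)
    & forall x, car pi x -> exists2 m : nat, (0 < m)%N &
        forall X : 'M[F]_2, (forall i j, vge v m (X i j)) ->
          act (1%:M + X) x = x].

Definition irreducible_rep pi : Prop :=
  (exists2 x, car pi x & x != 0) /\
  forall S : set pi, is_subspace S -> stable S -> S `<=` car pi ->
    S = [set 0] \/ S = car pi.

Definition K1 (c : nat) g : bool :=
  [&& [forall i, forall j, vge v 0 (g i j)], is_unit v (\det g),
      vge v c (g 1 0) & vge v c (g 1 1 - 1)].

Definition fixed_by_K1 pi (c : nat) (x : pi) : Prop :=
  forall g, K1 c g -> act g x = x.

Definition has_K1_fixed pi (c : nat) : Prop :=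
  exists x : pi, [/\ car pi x, x != 0 & fixed_by_K1 c x].

Definition rep_conductor pi : nat :=
  xget 0%N [set c | has_K1_fixed pi c /\
                    forall m, has_K1_fixed pi m -> (c <= m)%N].

Definition whittaker_functional pi (psi : F -> C) (l : pi -> C) : Prop :=
  [/\ forall (a : C) x y, car pi x -> car pi y ->
        l (a *: x + y) = a * l x + l y,
      forall b x, car pi x -> l (act (mx22 1 b 0 1) x) = psi b * l x
    & exists2 x, car pi x & l x != 0].

(* Coefficient of [X^k], [X = q^-(s - 1/2)], in the zeta integral
   [int_{F^*} W_x(diag(a, 1)) mu(a) |a|^(s - 1/2) d^*a]. *)
Definition zeta_coef pi (l : pi -> C) (mu : F -> C) (x : pi) (k : int) : C :=
  shell_integral v (fun a => l (act (mx22 a 0 0 1) x) * mu a) k.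

(* [pi] corresponds to [Ind_E^F Om] under the local Langlands correspondence,
   i.e. [L] and [epsilon] of all twists by characters [mu] of [F^*] agree:
     [L(s, pi x mu) = L(s, Om mu_E)],
     [epsilon(s, pi x mu, psi) = lambda epsilon(s, Om mu_E, psi_E)],
   with [mu_E = mu o N], those of [pi] being defined by the Jacquet-Langlands
   functional equation
     [Z(1-s, w x, (mu om)^-1) / L(1-s) = epsilon(s) Z(s, x, mu) / L(s)],
   [om] the central character.  [Z] and [Z'] below are the coefficients of the
   zeta integrals divided by their [L]-factors, and
   [epsilon(s, Om mu_E, psi_E)] is its value at [1/2] times [X^f]. *)
Definition langlands_induced (E : fieldExtType F) (vE : E -> int)
    (psi : F -> C) (pi : gl2rep C F) (Om : E -> C) : Prop :=
  let om := fun z : F => Om z%:A * quadratic_character C E z in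
  [/\ smooth_rep pi, irreducible_rep pi,
      forall z x, z != 0 -> car pi x -> act z%:M x = om z *: x
    & exists2 l : pi -> C, whittaker_functional psi l &
      forall mu : F -> C, mult_character v mu ->
        let nu := fun t : E => Om t * mu (normE t) in
        let f := (conductor vE nu)%:Z + level vE (psi_ext psi) in
        let Z := fun x k => zeta_coef l mu x k
          - L_coef vE q nu * zeta_coef l mu x (k - 1) in
        let mu' := fun a => (mu a * om a)^-1 in
        let Z' := fun x k => zeta_coef l mu' x k
          - L_coef vE q (fun t => (nu t)^-1) * zeta_coef l mu' x (k - 1) in
        [/\ forall x, car pi x -> exists M : int, forall k,
              Z x k != 0 -> `|k| <= M,
            exists2 x, car pi x & forall k, Z x k = (k == 0)%:R
          & forall x k, car pi x ->
              Z' (act (mx22 0 1 (-1) 0) x) (- k) =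
              lambda_factor v q vE psi * epsilon vE q (psi_ext psi) nu *
              Z x (k - f)]].

(* Central value of [epsilon(pi_E x chi)], [pi_E] the base change of [pi]: if
   [pi] corresponds to [Ind_L^F Theta] with [L] isomorphic to [E], then [pi_E]
   corresponds to the restriction of [Ind_L^F Theta] to the Weil group of [E],
   which is the sum of the characters [Theta o f] over the two
   [F]-isomorphisms [f : E -> L]. *)
Definition base_change_epsilon (L : fieldExtType F) (vL : L -> int)
    (E : fieldExtType F) (vE : E -> int) (psi : F -> C)
    (pi : gl2rep C F) (chi : E -> C) : C :=
  xget 0 [set e | exists (Theta : L -> C) (f1 f2 : 'AHom(E, L)),
    [/\ mult_character vL Theta,
        langlands_induced vL psi pi Theta,
        f1 != f2
      & e = epsilon vE q (psi_ext psi) (fun t => Theta (f1 t) * chi t) *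
            epsilon vE q (psi_ext psi) (fun t => Theta (f2 t) * chi t)]].

Definition invariant_inner_product pi (ip : pi -> pi -> C) : Prop :=
  [/\ forall (a : C) x y z, car pi x -> car pi y -> car pi z ->
        ip (a *: x + y) z = a * ip x z + ip y z,
      forall x y, car pi x -> car pi y -> ip y x = (ip x y)^*,
      forall x, car pi x -> x != 0 -> 0 < ip x x
    & forall g x y, g \in unitmx -> car pi x -> car pi y ->
        ip (act g x) (act g y) = ip x y].

(* [(x, y; y d, x)] for [t = x + y s] in [E = F(s)], where [s^2 = d]. *)
Definition quad_embed (E : fieldExtType F) (s : E) (d : F) (t : E) : 'M[F]_2 :=
  let x := coord [tuple 1; s] 0 t in
  let y := coord [tuple 1; s] 1 t in
  mx22 x y (y * d) x.

End GL2.

(** * The compactly induced representation *)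

Section CompactInduction.
Variables (C : numClosedFieldType) (F : fieldType) (v : F -> int).
Variables (psi : F -> C) (L : fieldExtType F) (theta : L -> C) (n : nat).
Variables (alpha s : L) (D : F).

(* [K(n) = 1 + lattice_n]; [n./2] and [uphalf n] are the lower and upper
   integer parts of [n/2]. *)
Definition lattice_n (X : 'M[F]_2) : Prop :=
  [/\ vge v (uphalf n) (X 0 0), vge v n./2 (X 0 1),
      vge v n./2.+1 (X 1 0) & vge v (uphalf n) (X 1 1)].

(* Graph of the character [theta~] of [J]; [J] is its domain. *)
Definition theta_tilde (j : 'M[F]_2) (z : C) : Prop :=
  exists (t : L) (X : 'M[F]_2),
    [/\ t != 0, lattice_n X,
        j = quad_embed s D t *m (1%:M + X)
      & z = theta t * psi (\tr (quad_embed s D alpha *m X))].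

Definition groupJ (j : 'M[F]_2) : Prop := exists z, theta_tilde j z.

(* Functions on [GL_2(F)] are extended by [0] to all matrices.  As [J] is open,
   compact support modulo [J] means support in finitely many cosets [J h]. *)
Definition cInd_car : set ('M[F]_2 -> C^o) :=
  [set f | [/\ forall g, g \notin unitmx -> f g = 0,
      forall j z (g : 'M[F]_2), theta_tilde j z -> f (j *m g) = z * f g,
      exists hs : seq 'M[F]_2, forall g, f g != 0 ->
        exists j h, [/\ groupJ j, h \in hs & g = j *m h]
    & exists2 m : nat, (0 < m)%N & forall g (X : 'M[F]_2),
        (forall i j, vge v m (X i j)) -> f (g *m (1%:M + X)) = f g]].

Definition cInd : gl2rep C F :=
  @GL2Rep C F ('M[F]_2 -> C^o) cInd_car (fun g f h => f (h *m g)).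

End CompactInduction.

(** * Integration over F^* \ E^* *)

Section Period.
Variables (R : realType) (F : fieldType).
Variables (E : fieldExtType F) (vE : E -> int).

Definition pt_ext : Type := E.
HB.instance Definition _ := GRing.Field.on pt_ext.
HB.instance Definition _ := isPointed.Build pt_ext 0.

(* Open subsets of [F^* \ E^*], viewed as [F^*]-invariant subsets of [E^*]. *)
Definition quotient_open : set (set pt_ext) :=
  [set A | [/\ forall t, A t -> t != 0,
      forall (a : F) (t : E), a != 0 -> A t -> A (a *: t)
    & forall t : E, A t -> exists2 m : nat, (0 < m)%N &
        forall u : E, vge vE m (u - 1) -> A (t * u)]].

Definition EmodF := g_sigma_algebraType quotient_open.

(* Haar measure on [F^* \ E^*] for which the image of [O_E^*], that is
   [O_F^* \ O_E^*], has volume 1. *)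
Definition normalized_haar (mu : {measure set EmodF -> \bar R}) : Prop :=
  (forall (a : E) (A : set EmodF), a != 0 -> measurable A ->
     mu [set (a * t : E) | t in (A : set E)] = mu A) /\
  mu [set t : E | exists (a : F) (u : E),
        [/\ a != 0, is_unit vE u & t = a *: u]] = 1%E.

Definition complex_integral (mu : {measure set EmodF -> \bar R})
    (f : E -> R[i]) : R[i] :=
  let D : set EmodF := [set t : E | t != 0] in
  Complex (\int[mu]_(t in D) complex.Re (f t))
          (\int[mu]_(t in D) complex.Im (f t)).

Definition period (mu : {measure set EmodF -> \bar R})
    (pi : gl2rep (R[i] : numClosedFieldType) F) (ip : pi -> pi -> R[i])
    (sqrtD : E) (D : F) (chi : E -> R[i]) (x y : pi) : R[i] :=
  complex_integral mu
    (fun t => ip (act (quad_embed sqrtD D t) x) y * chi t).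

End Period.

(* Main.v *)
(* Put N = (q - 1) q^(ceil(n/2) - 1).  The period is positive semidefinite: as
   F^* \ E^* is compact, {x, y} = kappa (P x, P y) where P projects onto the
   chi^-1-isotypic part.  Hence {y, y} = 0 forces P y = 0, and the off-diagonal
   terms vanish.  The translates phi_x are orthonormal, since K(n) acts on them
   through distinct characters, and their sum S is fixed by the conjugate H of
   the congruence subgroup of level 2n + 1.  A function in c-Ind fixed by H is
   determined by its value at 1: every g is l (1, b; 0, d) with l in L^*, and
   unless v(d) = 0 and v(b) >= floor(n/2) some element of H moves into K(n),
   where the character is nontrivial, under conjugation by (1, b; 0, d).  So the
   translated newform is c S with |c|^2 N = 1, and P S = P phi_x. *)

(* The valuation of [D'] is extracted from the exact conductor of [theta]. As [alpha] has trace 0,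
   [theta] at 1 + a + b s sees only psi(2 b varpi^-n), where s^2 = D', and any other valuation of s
   would push the conductor above or below 2n. Oddness of v(D') then drives the vanishing argument:
   d^2 and b^2 D' have valuations of different parity, so d^2 - b^2 D' never gains valuation by
   cancellation. The projection P is replaced by a finite sum. Finitely many vectors share a level
   m, on which the torus acts through a finite set T of cosets of F^* \ E^*, and the sum of chi(t)
   pi(t) over T plays the role of |T| P. That kappa is nonzero is read off from {phi_x, phi_x},
   which is why phi_x always belongs to the list of vectors considered. For the newform the bound
   c(pi) <= 2n + 1 suffices: a smaller exponent means a larger fixing group, so the translated
   newform is fixed by H in any case. *)
Require Import Defs.
From mathcomp Require Import zify ring measurable_realfun.

Set Implicit Arguments.
Unset Strict Implicit.
Unset Printing Implicit Defensive.

Import Order.TTheory GRing.Theory Num.Theory.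
Local Open Scope classical_set_scope.
Local Open Scope ring_scope.

(* [lia] case-splits on every boolean hypothesis, relevant or not. *)
Ltac val_lia := repeat match goal with
  | H : is_true (vge _ _ _) |- _ => clear H
  | H : is_true (~~ _) |- _ => clear H
  | H : is_true (is_unit _ _) |- _ => clear H
  | H : is_true (_ \in _) |- _ => clear H
  end; lia.

(** * Valuations and transversals *)

Section ValuationTheory.
Variables (K : fieldType) (v : K -> int).
Hypothesis hv : normalized_valuation v.
Implicit Types (x y : K) (k : int).

Lemma valM x y : x != 0 -> y != 0 -> v (x * y) = v x + v y.
Proof. by case: hv => h _ _; apply: h. Qed.

Lemma val1 : v 1 = 0.
Proof. by apply: (addrI (v 1)); rewrite addr0 -valM ?oner_neq0 // mulr1. Qed.

Lemma valV x : x != 0 -> v x^-1 = - v x.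
Proof.
move=> x0; have := valM x0 (invr_neq0 x0).
by rewrite mulfV // val1 => h; lia.
Qed.

Lemma valN x : v (- x) = v x.
Proof.
have [->|x0] := eqVneq x 0; first by rewrite oppr0.
have N1 : (-1 : K) != 0 by rewrite oppr_eq0 oner_neq0.
have := valM N1 N1; rewrite mulrNN mulr1 val1 => h.
by rewrite -mulN1r valM //; lia.
Qed.

Lemma valX x i : x != 0 -> v (x ^+ i) = v x * i%:Z.
Proof.
move=> x0; elim: i => [|i IH]; first by rewrite expr0 val1; lia.
by rewrite exprS valM ?expf_neq0 // IH; lia.
Qed.

Lemma vge0 k : vge v k 0.
Proof. by rewrite /vge eqxx. Qed.

Lemma vgeE k x : x != 0 -> vge v k x = (k <= v x).
Proof. by rewrite /vge => /negPf->. Qed.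

Lemma vge_val x : vge v (v x) x.
Proof. by rewrite /vge lexx orbT. Qed.

Lemma vgeW k j x : k <= j -> vge v j x -> vge v k x.
Proof. by rewrite /vge => kj /orP[->//|jx]; rewrite (le_trans kj jx) orbT. Qed.

Lemma vgeD k x y : vge v k x -> vge v k y -> vge v k (x + y).
Proof. by case: hv => _ h _; apply: h. Qed.

Lemma vgeN k x : vge v k (- x) = vge v k x.
Proof. by rewrite /vge oppr_eq0 valN. Qed.

Lemma vgeB k x y : vge v k x -> vge v k y -> vge v k (x - y).
Proof. by move=> hx hy; apply: vgeD; rewrite ?vgeN. Qed.

Lemma vgeMl k a x : a != 0 -> vge v k (a * x) = vge v (k - v a) x.
Proof.
move=> a0; have [->|x0] := eqVneq x 0; first by rewrite mulr0 !vge0.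
by rewrite !vgeE ?mulf_neq0 // valM //; lia.
Qed.

Lemma vgeMr k a x : a != 0 -> vge v k (x * a) = vge v (k - v a) x.
Proof. by move=> a0; rewrite mulrC vgeMl. Qed.

Lemma vgeM j k x y : vge v j x -> vge v k y -> vge v (j + k) (x * y).
Proof.
have [->|x0] := eqVneq x 0; first by rewrite mul0r !vge0.
by rewrite vgeMl // vgeE // => jx; apply: vgeW; lia.
Qed.

Lemma vge_sum (I : Type) (r : seq I) (P : pred I) (f : I -> K) k :
  (forall i, P i -> vge v k (f i)) -> vge v k (\sum_(i <- r | P i) f i).
Proof.
move=> h; apply: (big_ind (fun z => vge v k z)) => //; first exact: vge0.
exact: vgeD.
Qed.

Lemma vge_nat i : vge v 0 i%:R.
Proof.
elim: i => [|i IH]; first exact: vge0.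
by rewrite -natr1; apply: vgeD => //; rewrite vgeE ?oner_neq0 // val1.
Qed.

Lemma val_addl x y : x != 0 -> vge v (v x + 1) y -> x + y != 0 /\ v (x + y) = v x.
Proof.
move=> x0 hy.
have nx : ~~ vge v (v x + 1) x by rewrite vgeE //; lia.
have hn : ~~ vge v (v x + 1) (x + y).
  by apply: contra nx => h; have := vgeB h hy; rewrite addrK.
have xy0 : x + y != 0 by apply: contraNneq hn => ->; rewrite vge0.
split=> //; move: hn; rewrite vgeE // => h1.
have : vge v (v x) (x + y).
  by apply: vgeD; [exact: vge_val | apply: vgeW hy; lia].
by rewrite vgeE //; lia.
Qed.

Lemma val_near1 x : vge v 1 (x - 1) -> x != 0 /\ v x = 0.
Proof.
move=> h; have := @val_addl 1 (x - 1) (oner_neq0 _).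
by rewrite val1 add0r [1 + (x - 1)]addrC subrK; apply.
Qed.

Lemma is_unitP x : reflect (x != 0 /\ v x = 0) (is_unit v x).
Proof. by apply: (iffP andP) => -[-> /eqP]. Qed.

Lemma is_unitM x y : is_unit v x -> is_unit v y -> is_unit v (x * y).
Proof.
move=> /is_unitP[x0 hx] /is_unitP[y0 hy]; apply/is_unitP.
by rewrite mulf_neq0 // valM // hx hy.
Qed.

Lemma is_unitV x : is_unit v x -> is_unit v x^-1.
Proof.
by move=> /is_unitP[x0 hx]; apply/is_unitP; rewrite invr_neq0 // valV // hx.
Qed.

Lemma is_unit1 : is_unit v 1.
Proof. by rewrite /is_unit oner_neq0 val1 eqxx. Qed.

Lemma vge_unit x k : k <= 0 -> is_unit v x -> vge v k x.
Proof. by move=> k0 /is_unitP[x0 hx]; rewrite vgeE // hx. Qed.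

Lemma exists_val k : exists2 x, x != 0 & v x = k.
Proof.
case: hv => _ _ [w w0 vw]; case: k => k.
  by exists (w ^+ k); rewrite ?expf_neq0 // valX // vw mul1r.
exists (w ^+ k.+1)^-1; first by rewrite invr_neq0 // expf_neq0.
by rewrite valV ?expf_neq0 // valX // vw mul1r NegzE.
Qed.

End ValuationTheory.

(** * Representatives of the classes of a relation, and sums over them *)

Section Transversals.
Variables (K : fieldType) (A : pred K) (r : rel K).
Hypotheses (r_refl : {in A, forall x, r x x})
  (r_sym : {in A &, forall x y, r x y -> r y x})
  (r_trans : {in A & A & A, forall x y z, r x y -> r y z -> r x z}).

(** Greedy choice: an element of the covering list is kept when it is unrelated to those already
    kept. This is how compactness later yields a finite set of coset representatives. *)
Lemma transversal_cover (s0 : seq K) : {subset s0 <= A} ->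
  (forall x, x \in A -> has (r x) s0) -> exists s, transversal A r s.
Proof.
move=> sA cov.
suff [s [s1 s2 s3]] : exists s, [/\ {subset s <= s0},
    pairwise (fun x y => ~~ r x y) s & {in s0, forall x, has (r x) s}].
  exists s; split => // [x /s1 /sA //|x Ax].
  have /hasP[y ys rxy] := cov x Ax; have /hasP[z zs ryz] := s3 y ys.
  apply/hasP; exists z => //.
  by apply: (r_trans _ _ _ rxy ryz) => //; [exact: sA | exact/sA/s1].
elim: s0 sA {cov} => [|a s0 IH] sA; first by exists [::]; split.
have [x xs|s [s1 s2 s3]] := IH; first by apply: sA; rewrite inE xs orbT.
have [hs|/hasPn hs] := boolP (has (r a) s).
  exists s; split=> // [x xs|x]; first by rewrite inE s1 ?orbT.
  by rewrite inE => /orP[/eqP->//|]; apply: s3.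
exists (a :: s); split.
- by move=> x; rewrite !inE => /orP[->//|/s1->]; rewrite orbT.
- by rewrite pairwise_cons s2 andbT; apply/allP.
- move=> x; rewrite inE => /orP[/eqP->|/s3 /= ->]; last by rewrite orbT.
  by rewrite /= r_refl // sA // mem_head.
Qed.

Lemma transversal_inj s : transversal A r s -> {in s &, forall x y, r x y -> x = y}.
Proof.
move=> [sA pw _]; elim: s sA pw => // a s IH sA.
rewrite pairwise_cons => /andP[/allP ha pw] x y.
have sA' : {subset s <= A} by move=> z zs; apply: sA; rewrite inE zs orbT.
rewrite !inE => /orP[/eqP->|xs] /orP[/eqP->|ys] rxy //.
- by have := ha _ ys; rewrite rxy.
- have := ha _ xs; rewrite (r_sym _ _ rxy) //; first exact: sA'.
  by apply: sA; rewrite mem_head.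
- exact: IH.
Qed.

Lemma transversal_uniq s : transversal A r s -> uniq s.
Proof.
move=> [sA pw _]; elim: s sA pw => // a s IH sA.
rewrite pairwise_cons => /andP[/allP ha pw] /=.
rewrite IH // ?andbT; last by move=> z zs; apply: sA; rewrite inE zs orbT.
by apply/negP => /ha; rewrite r_refl // sA // mem_head.
Qed.

(** Each element goes to its representative in the other list. The map is injective, and so is its
    analogue in the other direction, so the lengths agree and the map is a bijection. *)
Lemma transversal_reindex s s' : transversal A r s -> transversal A r s' ->
  exists c : K -> K, perm_eq (map c s) s' /\ {in s, forall x, r x (c x)}.
Proof.
have half s1 s2 : transversal A r s1 -> transversal A r s2 ->
    exists c : K -> K, [/\ uniq (map c s1), {subset map c s1 <= s2}
      & {in s1, forall x, r x (c x)}].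
  move=> t1 t2; have [sA1 _ _] := t1; have [sA2 _ cov2] := t2.
  pose c x := nth 0 s2 (find (r x) s2).
  have cs x : x \in s1 -> c x \in s2.
    by move=> /sA1 /cov2 h; rewrite mem_nth // -has_find.
  have rc x : x \in s1 -> r x (c x) by move=> /sA1 /cov2; apply: nth_find.
  exists c; split=> // [|y /mapP[x xs ->]]; last exact: cs.
  rewrite map_inj_in_uniq ?(transversal_uniq t1) // => x y xs ys eqc.
  apply: (transversal_inj t1) => //.
  have Ac z (zs : z \in s1) : c z \in A by apply/sA2/cs.
  apply: (r_trans (sA1 _ xs) (Ac _ xs) (sA1 _ ys) (rc x xs)).
  by rewrite eqc; apply: r_sym (sA1 _ ys) (Ac _ ys) (rc y ys).
move=> t1 t2; have [c [u1 sub1 rc]] := half _ _ t1 t2.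
have [c' [u2 sub2 _]] := half _ _ t2 t1.
exists c; split=> //.
have le21 : (size s' <= size (map c s))%N.
  by rewrite size_map -(size_map c' s'); apply: uniq_leq_size.
have [_ eqs] := uniq_min_size u1 sub1 le21.
by apply: uniq_perm => //; exact: transversal_uniq t2.
Qed.

Lemma transversal_sum (V : zmodType) (f : K -> V) s s' :
  {in A &, forall x y, r x y -> f x = f y} ->
  transversal A r s -> transversal A r s' ->
  \sum_(x <- s) f x = \sum_(x <- s') f x.
Proof.
move=> fr t1 t2; have [c [pc rc]] := transversal_reindex t1 t2.
have [[sA _ _] [sA' _ _]] := (t1, t2).
rewrite -(perm_big _ pc) big_map; apply: eq_big_seq => x xs.
apply: fr (sA _ xs) _ (rc _ xs); apply: sA'.
by rewrite -(perm_mem pc); apply: map_f.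
Qed.

(** [h] inverts [g] up to [r]. The single adjunction-like identity between them gives both
    separation and covering; [g] is multiplication by an invertible element in every application. *)
Lemma transversal_map (g h : K -> K) s : transversal A r s ->
  {in A, forall x, g x \in A} -> {in A, forall x, h x \in A} ->
  {in A &, forall x y, r (g x) y = r x (h y)} ->
  {in A, forall x, r (h (g x)) x} -> transversal A r (map g s).
Proof.
move=> t gA hA gh hg; have [sA _ cov] := t.
split=> [y /mapP[x xs ->]|| y Ay]; first exact/gA/sA.
- rewrite pairwise_map; apply/(pairwiseP 0) => i j si sj ij /=.
  have [xs ys] : nth 0 s i \in s /\ nth 0 s j \in s by rewrite !mem_nth.
  have [Ax Ay] := (sA _ xs, sA _ ys); have Agy := gA _ Ay.
  apply/negP; rewrite gh // => rij.
  have /eqP := transversal_inj t xs ys (r_trans Ax (hA _ Agy) Ay rij (hg _ Ay)).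
  by rewrite nth_uniq ?(transversal_uniq t) // => /eqP eij; rewrite eij ltnn in ij.
- have /hasP[x xs rx] := cov _ (hA _ Ay).
  apply/hasP; exists (g x); first by apply/mapP; exists x.
  have [Ax Ahy] := (sA _ xs, hA _ Ay).
  by apply: r_sym (gA _ Ax) (Ay) _; rewrite gh //; apply: r_sym Ahy Ax rx.
Qed.

End Transversals.

Lemma transversal_of_inj (K : fieldType) (A : pred K) (r : rel K) (s : seq K) :
  {subset s <= A} -> uniq s -> {in s &, forall x y, r x y -> x = y} ->
  (forall x, x \in A -> has (r x) s) -> transversal A r s.
Proof.
move=> sA us inj cov; split=> //; apply/(pairwiseP 0) => i j si sj ij.
apply/negP => /(inj _ _ (mem_nth 0 si) (mem_nth 0 sj)) /eqP.
by rewrite nth_uniq // => /eqP eij; rewrite eij ltnn in ij.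
Qed.

(** * Digit expansions and the number of units modulo a power of the uniformizer *)

Section Congruence.
Variables (K : fieldType) (v : K -> int).
Hypothesis hv : normalized_valuation v.

Definition cong (k : int) : rel K := fun x y => vge v k (x - y).

Lemma cong_refl k x : cong k x x.
Proof. by rewrite /cong subrr vge0. Qed.

Lemma cong_sym k x y : cong k x y = cong k y x.
Proof. by rewrite /cong -(vgeN hv) opprB. Qed.

Lemma cong_trans k x y z : cong k x y -> cong k y z -> cong k x z.
Proof. by rewrite /cong => h1 h2; have := vgeD hv h1 h2; rewrite subrKA. Qed.

Variable w : K.
Hypotheses (w0 : w != 0) (vw : v w = 1).

(** Since [A] is a union of classes modulo varpi, only the leading digit is constrained. Reducing
    modulo varpi recovers that digit, and dividing the difference by [w] recovers the rest. *)
Lemma digit_transversal (A : pred K) (s t : seq K) (k : nat) :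
  (forall x, A x -> vge v 0 x) ->
  (forall x y, A x -> cong 1 x y -> A y) ->
  transversal A (cong 1) s -> transversal (vge v 0) (cong k) t ->
  transversal A (cong k.+1) [seq x + w * y | x <- s, y <- t].
Proof.
move=> AO Acl ts tt; have [sA _ scov] := ts; have [tO _ tcov] := tt.
have wO y : vge v 0 y -> vge v 1 (w * y) by rewrite vgeMl // vw.
have injs := transversal_inj (fun x y _ _ => etrans (cong_sym _ _ _)) ts.
have injt := transversal_inj (fun x y _ _ => etrans (cong_sym _ _ _)) tt.
have key x x' y y' : x \in s -> x' \in s -> y \in t -> y' \in t ->
    cong k.+1 (x + w * y) (x' + w * y') -> x = x' /\ y = y'.
  move=> xs xs' yt yt' h.
  have exx : x = x'.
    apply: injs => //.
    have -> : x = x + w * y - w * y by ring.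
    have -> : x' = x' + w * y' - w * y' by ring.
    rewrite /cong; set a := x + _; set b := x' + _.
    have -> : a - w * y - (b - w * y') = (a - b) + w * (y' - y) by ring.
    apply: vgeD => //; first by apply: vgeW h; val_lia.
    by apply: wO; apply: vgeB => //; [exact: tO yt' | exact: tO yt].
  split=> //; apply: injt => //; move: h; rewrite exx /cong.
  have -> : x' + w * y - (x' + w * y') = w * (y - y') by ring.
  by rewrite vgeMl // vw; apply: vgeW; val_lia.
apply: transversal_of_inj.
- move=> z /allpairsP[[x y] /= [xs yt ->]].
  apply: (@Acl x); first exact: sA.
  by rewrite /cong opprD addrA subrr add0r vgeN //; apply/wO/tO.
- apply: allpairs_uniq; [exact: (transversal_uniq (fun x _ => cong_refl _ x) ts)
    | exact: (transversal_uniq (fun x _ => cong_refl _ x) tt)|].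
  move=> [x y] [x' y'] /allpairsP[[a b] /= [xs yt [-> ->]]].
  move=> /allpairsP[[a' b'] /= [xs' yt' [-> ->]]] e.
  have h : cong k.+1 (a + w * b) (a' + w * b') by rewrite e cong_refl.
  by have [-> ->] := key _ _ _ _ xs xs' yt yt' h.
- move=> z z' /allpairsP[[x y] /= [xs yt ->]] /allpairsP[[x' y'] /= [xs' yt' ->]].
  by move=> /key[] // -> ->.
- move=> z Az; have /hasP[x xs rx] := scov z Az.
  have zx : vge v 0 ((z - x) / w).
    by rewrite vgeMr ?invr_eq0 // valV // vw.
  have /hasP[y yt ry] := tcov _ zx.
  apply/hasP; exists (x + w * y); first by apply/allpairsP; exists (x, y).
  rewrite /cong; have -> : z - (x + w * y) = w * ((z - x) / w - y) by field.
  by rewrite vgeMl // vw; apply: vgeW ry; val_lia.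
Qed.

Variables (q : nat) (s : seq K).
Hypotheses (hs : transversal (vge v 0) (cong 1) s) (sq : size s = q).

Lemma integer_transversal (k : nat) :
  exists2 t, transversal (vge v 0) (cong k) t & size t = (q ^ k)%N.
Proof.
elim: k => [|k [t tt st]].
  exists [:: 0] => //; split.
  - by move=> x; rewrite inE => /eqP ->; exact: vge0.
  - by [].
  - by move=> x Ox /=; rewrite /cong subr0 orbF.
exists [seq x + w * y | x <- s, y <- t]; last by rewrite size_allpairs st sq expnS.
apply: digit_transversal => // x y Ox h.
rewrite -(subKr x y); apply: vgeB => //.
by apply: vgeW h.
Qed.

(** A unit is an integer with nonzero leading digit: one of the q choices is lost there, and the
    other k - 1 digits stay free. *)
Lemma unit_transversal (k : nat) : (0 < k)%N ->
  exists2 t, transversal (is_unit v) (cong k) t & size t = (q.-1 * q ^ k.-1)%N.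
Proof.
case: k => // k _; have [sO spw scov] := hs.
have unitE x : vge v 0 x -> is_unit v x = ~~ vge v 1 x.
  have [->|x0] := eqVneq x 0; first by rewrite !vge0 /is_unit eqxx.
  rewrite !vgeE // /is_unit x0 /=; val_lia.
have [t tt st] := integer_transversal k.
pose s' := [seq x <- s | is_unit v x].
have ts' : transversal (is_unit v) (cong 1) s'.
  split.
  - by move=> x; rewrite mem_filter => /andP[].
  - by rewrite pairwise_filter.
  - move=> x ux0; have ux : is_unit v x by []; have Ox : vge v 0 x by apply: vge_unit.
    have /hasP[y ys rxy] := scov x Ox; apply/hasP; exists y => //.
    rewrite mem_filter ys andbT unitE ?sO //; last exact: sO.
    apply: contraL ux => h; rewrite unitE // negbK.
    by rewrite -(subrK y x); apply: vgeD.
exists [seq x + w * y | x <- s', y <- t].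
  apply: digit_transversal => // [x|x y]; first exact: vge_unit.
  move=> ux h; have Ox : vge v 0 x by apply: vge_unit.
  have Oy : vge v 0 y by rewrite -(subKr x y); apply: vgeB => //; apply: vgeW h.
  rewrite unitE //; apply: contraL ux => h'; rewrite unitE // negbK.
  by rewrite -(subrK y x); apply: vgeD.
rewrite size_allpairs st /=; congr (_ * _)%N.
have /hasP[z zs rz] := scov 0 (vge0 v 0).
have vz : vge v 1 z by move: rz; rewrite /cong sub0r vgeN.
(* [z] is the digit representing the residue class 0, the only non-unit in [s]. *)
have -> : s' = rem z s.
  rewrite rem_filter ?(transversal_uniq _ hs) //; last by move=> ? _; exact: cong_refl.
  apply: eq_in_filter => x xs; rewrite unitE ?sO //=; last exact: sO.
  have [->|nxz] := eqVneq x z; first by rewrite vz.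
  apply: contra nxz => vx; apply/eqP.
  have := transversal_inj (fun x y _ _ => etrans (cong_sym _ _ _)) hs.
  by apply=> //; apply: vgeB.
by rewrite size_rem // sq.
Qed.

End Congruence.

(** For odd p, 1 = p - 2 floor(p/2). If 2 were in the maximal ideal together with p, so would be
    1. *)
Lemma two_unit (K : fieldType) (v : K -> int) (p : nat) :
  normalized_valuation v -> [pchar K] =i pred0 -> prime p -> p <> 2%N ->
  vge v 1 p%:R -> is_unit v 2%:R.
Proof.
move=> hv ch pr p2 hp.
have two0 : (2%:R : K) != 0.
  by apply/negP => h; have := ch 2%N; rewrite !inE h.
apply/is_unitP; split=> //; have := vge_nat hv 2; rewrite vgeE // => h0.
have [h1|] := boolP (1 <= v 2%:R); last by val_lia.
have : vge v 1 (1 : K).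
  have -> : 1 = p%:R - 2%:R * p./2%:R :> K.
    rewrite -natrM mulnC muln2 -{1}(odd_double_half p).
    by case: (even_prime pr) => // ->; rewrite natrD addrK.
  apply: vgeB => //; rewrite -[1 : int]addr0; apply: vgeM => //; last exact: vge_nat.
  by rewrite vgeE.
by rewrite vgeE ?oner_neq0 // val1.
Qed.

(** * Ramified quadratic extensions *)

Section RamifiedQuadratic.
Variables (F : fieldType) (v : F -> int) (E : fieldExtType F) (vE : E -> int).
Hypotheses (hv : normalized_valuation v) (hE : ramified_quadratic v vE).

Lemma normalized_ext : normalized_valuation vE.
Proof. by case: hE. Qed.

Lemma vext_alg (a : F) : a != 0 -> vE a%:A = v a *+ 2.
Proof. by case: hE => _ _; apply. Qed.

Lemma vge_alg (a : F) (j : int) : vge vE (j *+ 2) a%:A = vge v j a.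
Proof.
have [->|a0] := eqVneq a 0; first by rewrite scale0r !vge0.
by rewrite !vgeE ?vext_alg //; [val_lia | rewrite scaler_eq0 negb_or a0 oner_neq0].
Qed.

Lemma trE_linear (a : F) (x y : E) : trE (a *: x + y) = a * trE x + trE y.
Proof.
by rewrite /trE /mult_matrix amulr_is_linear passmx.mxof_linear mxtraceD mxtraceZ.
Qed.

Lemma trE_alg (a : F) : trE (a%:A : E) = 2%:R * a.
Proof.
have h : trE (1 : E) = 2%:R.
  rewrite /trE /mult_matrix.
  have -> : amulr (1 : E) = \1%VF by apply/lfunP => z; rewrite lfunE /= mulr1 lfunE.
  rewrite passmx.mxof1 ?mxtrace1; first by case: hE => ->.
  exact: basis_free (vbasisP _).
have tr0 : trE (0 : E) = 0.
  by have := trE_linear (-1) (0 : E) 0; rewrite scaler0 addr0 mulN1r addNr.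
by have := trE_linear a 1 0; rewrite addr0 h tr0 addr0 mulrC.
Qed.

Section Uniformizer.
Variable s : E.
Hypotheses (s0 : s != 0) (vs : vE s = 1).

(** The valuations of x and of y s in E have different parity, so the sum has the smaller of the two
    and no cancellation occurs. *)
Lemma vge_ext_even (x y : F) (j : int) :
  vge vE (j *+ 2) (x%:A + y *: s) = vge v j x && vge v j y.
Proof.
have [->|y0] := eqVneq y 0; first by rewrite scale0r addr0 vge_alg vge0 andbT.
have ys0 : y *: s != 0 by rewrite scaler_eq0 negb_or y0.
have vys : vE (y *: s) = v y *+ 2 + 1.
  by rewrite -mulr_algl valM ?vext_alg ?vs // ?scaler_eq0 ?negb_or ?y0 ?oner_neq0 //;
    exact: normalized_ext.
have [->|x0] := eqVneq x 0.
  by rewrite scale0r add0r vge0 !vgeE // vys; val_lia.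
have xA0 : x%:A != 0 :> E by rewrite scaler_eq0 negb_or x0 oner_neq0.
have [le|lt] := leP (v x) (v y).
  have [|n0 e] := val_addl normalized_ext xA0 (y := y *: s).
    by rewrite vgeE // vys vext_alg //; val_lia.
  by rewrite !vgeE // e vext_alg //; val_lia.
have [|] := val_addl normalized_ext ys0 (y := x%:A).
  by rewrite vgeE // vys vext_alg //; val_lia.
by rewrite addrC => n0 e; rewrite !vgeE // e vys; val_lia.
Qed.

(** Compared with the even threshold, only the condition on x tightens, because its valuation in E
    is even. *)
Lemma vge_ext_odd (x y : F) (j : int) :
  vge vE (j *+ 2 + 1) (x%:A + y *: s) = vge v (j + 1) x && vge v j y.
Proof.
have h1 : vge vE (j *+ 2 + 1) (y *: s) = vge v j y.
  have [->|y0] := eqVneq y 0; first by rewrite scale0r !vge0.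
  have yA0 : y%:A != 0 :> E by rewrite scaler_eq0 negb_or y0 oner_neq0.
  rewrite -mulr_algl vgeMl ?vext_alg //; last exact: normalized_ext.
  by rewrite !vgeE // vs; val_lia.
apply/idP/andP => [h|[hx hy]].
  have := vge_ext_even x y j; rewrite (vgeW _ h); last by val_lia.
  move=> /esym/andP[_ hy]; split=> //; rewrite -vge_alg.
  have : vge vE (j *+ 2 + 1) x%:A.
    by rewrite -[x%:A](addrK (y *: s)); apply: vgeB => //; [exact: normalized_ext | rewrite h1].
  have [->|x0] := eqVneq x 0; first by rewrite scale0r !vge0.
  have xA0 : x%:A != 0 :> E by rewrite scaler_eq0 negb_or x0 oner_neq0.
  by rewrite !vgeE // vext_alg //; val_lia.
apply: vgeD; [exact: normalized_ext | | by rewrite h1].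
by move: hx; rewrite -vge_alg; apply: vgeW; val_lia.
Qed.

Lemma uniformizer_free : free [:: 1; s].
Proof.
rewrite free_cons seq1_free s0 andbT span_seq1; apply/negP => /vlineP[k e].
have := vge_ext_odd 1 (- k) 0; rewrite scale1r scaleNr -e subrr vge0.
by move=> /esym/andP[]; rewrite vgeE ?oner_neq0 // val1.
Qed.

Lemma uniformizer_basis : basis_of fullv [tuple 1; s].
Proof.
by rewrite basisEfree uniformizer_free subvf /=; case: hE => ->.
Qed.

Lemma uniformizer_coord (t : E) : exists x y : F, t = x%:A + y *: s.
Proof.
have := coord_basis uniformizer_basis (memvf t).
by rewrite big_ord_recl big_ord1 /= => e; eexists; eexists; exact: e.
Qed.

Lemma coordE (x y : F) :
  coord [tuple 1; s] 0 (x%:A + y *: s) = x /\ coord [tuple 1; s] 1 (x%:A + y *: s) = y.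
Proof.
have fr : free [tuple 1; s] by exact: uniformizer_free.
have c i j := coord_free i j fr.
have := c 0 0; have := c 0 1; have := c 1 0; have := c 1 1 => /= c11 c10 c01 c00.
by rewrite !linearD !linearZ /= c11 c10 c01 c00 !mulr0 !mulr1 addr0 add0r.
Qed.

Lemma quad_embedE (d x y : F) :
  quad_embed s d (x%:A + y *: s) = mx22 x y (y * d) x.
Proof. by rewrite /quad_embed; have [-> ->] := coordE x y. Qed.

End Uniformizer.

(** With a uniformizer u and s = x + y u, u^2 = b + t u where v(t) >= 1. The u-coordinate of s^2
    vanishes, which gives x = - y t / 2; as 2 is a unit, v(x) > v(y), and the odd term y u
    dominates. *)
Lemma odd_valuation_of_sqrt (s : E) (d : F) : is_unit v 2%:R ->
  (forall a, s != a%:A) -> s ^+ 2 = d%:A -> exists j : int, vE s = j *+ 2 + 1.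
Proof.
move=> /is_unitP[two0 v2] sF s2.
have [u u0 vu] := exists_val normalized_ext 1.
have [x [y es]] := uniformizer_coord u0 vu s.
have [b [t eu]] := uniformizer_coord u0 vu (u ^+ 2).
have y0 : y != 0.
  by apply: contraNneq (sF x) => y0; rewrite es y0 scale0r addr0.
have /andP[_ vt] : vge v 1 b && vge v 1 t.
  by rewrite -(vge_ext_even u0 vu) -eu vgeE ?expf_neq0 // valX // ?vu //; exact: normalized_ext.
have e : d%:A = (x ^+ 2 + y ^+ 2 * b)%:A + (2%:R * x * y + y ^+ 2 * t) *: u.
  rewrite -s2 es sqrrD !exprZn expr1n eu.
  have h (a : F) (z : E) : a *: z = in_alg E a * z := esym (mulr_algl a z).
  by rewrite !h; ring.
have e1 : 2%:R * x * y + y ^+ 2 * t = 0.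
  have [_ <-] := coordE u0 vu (x ^+ 2 + y ^+ 2 * b) (2%:R * x * y + y ^+ 2 * t).
  by rewrite -e; have [_] := coordE u0 vu d 0; rewrite scale0r addr0.
have ex : x = - (y * t) / 2%:R.
  apply: (mulfI two0); apply: (mulIf y0); apply/eqP; rewrite -subr_eq0 -e1.
  by apply/eqP; field.
have hyu : y *: u != 0 by rewrite scaler_eq0 negb_or y0.
have vyu : vE (y *: u) = v y *+ 2 + 1.
  by rewrite -mulr_algl valM ?vext_alg ?vu // ?scaler_eq0 ?negb_or ?y0 ?oner_neq0 //;
    exact: normalized_ext.
exists (v y); rewrite es addrC -vyu.
have [] // := val_addl normalized_ext hyu (y := x%:A).
rewrite vyu (_ : _ + 1 = (v y + 1) *+ 2); last by val_lia.
rewrite vge_alg ex vgeMr ?invr_eq0 // valV // v2 vgeN //.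
by rewrite vgeMl //; apply: vgeW vt; val_lia.
Qed.

End RamifiedQuadratic.

(** * Two by two matrices and the embedding of a quadratic extension *)

Section TwoByTwo.
Variable F : fieldType.
Implicit Types (A B : 'M[F]_2).

Lemma mx22E (a b c e : F) : (mx22 a b c e 0 0 = a) * (mx22 a b c e 0 1 = b) *
  (mx22 a b c e 1 0 = c) * (mx22 a b c e 1 1 = e).
Proof. by rewrite !mxE. Qed.

Lemma ord2P (i : 'I_2) : i = 0 \/ i = 1.
Proof.
by case: i => [[|[|i]] hi]; [left | right | by []]; apply: val_inj.
Qed.

Lemma sum_ord2 (f : 'I_2 -> F) : \sum_i f i = f 0 + f 1.
Proof. by rewrite big_ord_recl big_ord1; congr (_ + f _); apply: val_inj. Qed.

Lemma mx22_eta A : A = mx22 (A 0 0) (A 0 1) (A 1 0) (A 1 1).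
Proof.
by apply/matrixP => i j; case: (ord2P i) => ->; case: (ord2P j) => ->; rewrite mx22E.
Qed.

Lemma mulmx22 (a b c e a' b' c' e' : F) :
  mx22 a b c e *m mx22 a' b' c' e' =
  mx22 (a * a' + b * c') (a * b' + b * e') (c * a' + e * c') (c * b' + e * e').
Proof. by rewrite [LHS]mx22_eta !mxE !sum_ord2 !mx22E. Qed.

Lemma addmx22 (a b c e a' b' c' e' : F) :
  mx22 a b c e + mx22 a' b' c' e' = mx22 (a + a') (b + b') (c + c') (e + e').
Proof. by rewrite [LHS]mx22_eta !mxE. Qed.

Lemma scalar_mx22 (a : F) : a%:M = mx22 a 0 0 a.
Proof. by rewrite [LHS]mx22_eta !mxE. Qed.

Lemma tr_mx22 (a b c e : F) : \tr (mx22 a b c e) = a + e.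
Proof. by rewrite /mxtrace sum_ord2 !mx22E. Qed.

Lemma mx22_unit (a b c e : F) : a * e - b * c != 0 -> mx22 a b c e \in unitmx.
Proof.
set dd := _ - _ => d0; have := @mulmx1_unit _ _ (mx22 a b c e)
  (mx22 (e / dd) (- b / dd) (- c / dd) (a / dd)).
case=> //; rewrite mulmx22 scalar_mx22 /dd; congr mx22; field => //.
Qed.

Lemma det_mx22 A : \det A = A 0 0 * A 1 1 - A 0 1 * A 1 0.
Proof.
rewrite (expand_det_row _ 0) sum_ord2 /cofactor !det_mx11 !mxE /=.
have -> : lift 0 0 = 1 :> 'I_2 by apply: val_inj.
have -> : lift 1 0 = 0 :> 'I_2 by apply: val_inj.
by rewrite !expr0 mul1r; ring.
Qed.

End TwoByTwo.

Section QuadraticEmbedding.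
Variables (F : fieldType) (v : F -> int) (E : fieldExtType F) (vE : E -> int).
Hypotheses (hv : normalized_valuation v) (hE : ramified_quadratic v vE).
Variables (s : E) (d : F).
Hypotheses (s0 : s != 0) (vs : vE s = 1) (s2 : s ^+ 2 = d%:A).

Lemma quad_embedM (t u : E) :
  quad_embed s d (t * u) = quad_embed s d t *m quad_embed s d u.
Proof.
have [a [b ->]] := uniformizer_coord hv hE s0 vs t.
have [a' [b' ->]] := uniformizer_coord hv hE s0 vs u.
have -> : (a%:A + b *: s) * (a'%:A + b' *: s) =
    (a * a' + b * b' * d)%:A + (a * b' + b * a') *: s.
  have h (c : F) (z : E) : c *: z = in_alg E c * z := esym (mulr_algl c z).
  by move: s2; rewrite !h => s2'; ring: s2'.
rewrite !(quad_embedE hv hE s0 vs) mulmx22; congr mx22; ring.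
Qed.

Lemma quad_embed_alg (a : F) : quad_embed s d a%:A = a%:M.
Proof.
have := quad_embedE hv hE s0 vs d a 0.
by rewrite scale0r addr0 mul0r scalar_mx22.
Qed.

Lemma quad_embed_unit (t : E) : t != 0 -> quad_embed s d t \in unitmx.
Proof.
move=> t0; have [] // := @mulmx1_unit _ _ (quad_embed s d t) (quad_embed s d t^-1).
by rewrite -quad_embedM mulfV // -quad_embed_alg scale1r.
Qed.

Lemma quad_embed_near1 (t : E) (m : int) : vge v 0 d -> vge vE (m *+ 2) (t - 1) ->
  exists2 X : 'M[F]_2, (forall i j, vge v m (X i j)) & quad_embed s d t = 1%:M + X.
Proof.
move=> vd; have [a [b e]] := uniformizer_coord hv hE s0 vs (t - 1).
rewrite e (vge_ext_even hE s0 vs) => /andP[va vb].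
exists (mx22 a b (b * d) a).
  have vbd : vge v m (b * d) by rewrite -[m]addr0; apply: vgeM.
  by move=> i j; case: (ord2P i) => ->; case: (ord2P j) => ->; rewrite mx22E.
have -> : t = (1 + a)%:A + b *: s by rewrite scalerDl scale1r -addrA -e addrC subrK.
rewrite (quad_embedE hv hE s0 vs) scalar_mx22 addmx22; congr mx22; ring.
Qed.

End QuadraticEmbedding.

Lemma least_nat (P : nat -> Prop) : (exists m, P m) ->
  exists c, P c /\ forall m, P m -> (c <= m)%N.
Proof.
move=> [m Pm]; pose p i := `[< P i >].
have ep : exists i, p i by exists m; apply/asboolP.
exists (ex_minn ep); case: ex_minnP => c /asboolP Pc min; split=> // k Pk.
by apply: min; apply/asboolP.
Qed.

Lemma xget_least (P : nat -> Prop) : (exists m, P m) ->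
  let c := xget 0%N [set c | P c /\ forall m, P m -> (c <= m)%N] in
  P c /\ forall m, P m -> (c <= m)%N.
Proof. by move=> /least_nat ex; rewrite /=; case: xgetP => //= h; case: ex => c /h. Qed.

Lemma val_sqrt (F : fieldType) (v : F -> int) (E : fieldExtType F) (vE : E -> int)
    (d : F) (s : E) : ramified_quadratic v vE -> d != 0 -> v d = 1 ->
  s ^+ 2 = d%:A -> s != 0 /\ vE s = 1.
Proof.
move=> hE d0 vd s2; have s0 : s != 0.
  apply: contraNneq d0 => e; move/eqP: s2.
  by rewrite e expr0n /= eq_sym scaler_eq0 oner_eq0 orbF.
split=> //; have := valX (normalized_ext hE) 2 s0; rewrite s2 (vext_alg hE) // vd; lia.
Qed.

(** * The valuation of [D'] from the conductor of [theta] *)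

Section Conductor.
Variables (C : numClosedFieldType) (F : fieldType) (v : F -> int).
Hypothesis hv : normalized_valuation v.
Hypothesis two_u : is_unit v 2%:R.
Variables (varpi : F) (varpi0 : varpi != 0) (vvarpi : v varpi = 1).
Variables (psi : F -> C) (hpsi0 : trivial_on_ideal v psi 0).
Hypothesis hpsi1 : ~ trivial_on_ideal v psi (-1).
Variables (L : fieldExtType F) (vL : L -> int).
Hypothesis hL : ramified_quadratic v vL.
Variables (theta : L -> C) (htheta : mult_character vL theta).
Variables (n : nat) (hn : (1 <= n)%N) (hc : conductor vL theta = (2 * n)%N).
Variables (alpha : L) (alpha0 : alpha != 0) (alpha_tr : trE alpha = 0).
Hypothesis halpha : forall u : L, vge vL n u -> theta (1 + u) = psi_ext psi (alpha * u).
Variables (D' : F) (hD' : D'%:A = alpha ^- 2 * (varpi ^- (2 * n))%:A :> L).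

Let s := alpha^-1 * (varpi ^- n)%:A.

Lemma sqrt_neq0 : s != 0.
Proof.
by rewrite mulf_neq0 ?invr_eq0 // scaler_eq0 negb_or invr_eq0 expf_neq0 // oner_neq0.
Qed.

Lemma sqrt_sqr : s ^+ 2 = D'%:A.
Proof.
rewrite hD' /s exprMn exprVn; congr (_ * _).
rewrite -[LHS](rmorphXn (in_alg L)) /=; congr (_ *: 1).
by rewrite exprVn -exprM mulnC.
Qed.

Lemma D'_neq0 : D' != 0.
Proof.
by apply: contraNneq (expf_neq0 2 sqrt_neq0) => e; rewrite sqrt_sqr e scale0r.
Qed.

Lemma alpha_sqrt : alpha = (varpi ^- n / D')%:A * s.
Proof.
have -> : alpha = s^-1 * (varpi ^- n)%:A.
  by rewrite /s invfM invrK mulfVK // scaler_eq0 negb_or invr_eq0 expf_neq0 // oner_neq0.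
have e : s^-1 = s / (D'%:A) by rewrite -sqrt_sqr; field; exact: sqrt_neq0.
have eV : (D'^-1)%:A = (D'%:A)^-1 :> L := fmorphV (in_alg L) D'.
have eM a b : (a * b)%:A = a%:A * b%:A :> L := rmorphM (in_alg L) a b.
by rewrite e eM eV [RHS]mulrC mulrA mulrAC.
Qed.

(** alpha s = varpi^-n lies in F while alpha has trace 0, so pairing with alpha isolates the
    s-coordinate. *)
Lemma alpha_mul (a b : F) :
  trE (alpha * (a%:A + b *: s)) = 2%:R * (b * varpi ^- n).
Proof.
have -> : alpha * (a%:A + b *: s) = a *: alpha + (b * varpi ^- n)%:A.
  rewrite mulrDr -scalerAr mulr1 -scalerAr; congr (_ + _).
  by rewrite /s mulrA mulfV // mul1r scalerA.
by rewrite trE_linear alpha_tr mulr0 add0r (trE_alg hL).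
Qed.

(** Writing the odd valuation of s as 2j + 1, conductor at most 2n excludes j > 0 and conductor at
    least 2n excludes j < 0. *)
Lemma sqrt_uniformizer : vL s = 1.
Proof.
have [two0 v2] := is_unitP _ _ two_u.
have vw k : v (varpi ^- k) = - k%:Z by rewrite valV ?expf_neq0 // valX // vvarpi mul1r.
have w0 k : varpi ^- k != 0 by rewrite invr_eq0 expf_neq0.
have A0 (a : F) : a != 0 -> a%:A != 0 :> L.
  by move=> a0; rewrite scaler_eq0 negb_or a0 oner_neq0.
(* Otherwise alpha would lie in F, where the trace is multiplication by 2 and cannot vanish on
   alpha. *)
have sF a : s != a%:A.
  apply/eqP => e; have := alpha_tr; rewrite alpha_sqrt e.
  have eM x y : x%:A * y%:A = (x * y)%:A :> L := esym (rmorphM (in_alg L) x y).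
  rewrite eM (trE_alg hL).
  move/eqP; rewrite mulf_eq0 (negPf two0) mulf_eq0 /=.
  rewrite mulf_eq0 (negPf (w0 n)) invr_eq0 (negPf D'_neq0) /= => /eqP a0.
  by have := sqrt_neq0; rewrite e a0 scale0r eqxx.
have [j vs] := odd_valuation_of_sqrt hv hL two_u sF sqrt_sqr.
have hvL := normalized_ext hL.
have [htr hmin] : trivial_on_units vL theta (2 * n) /\
    forall m, trivial_on_units vL theta m -> (2 * n <= m)%N.
  by rewrite -hc; apply: xget_least; case: htheta.
(* Rescaling by [c] turns s into a uniformizer, as the coordinate criteria require. *)
have [c c0 vc] := exists_val hv (- j).
have s'0 : c *: s != 0 by rewrite scaler_eq0 negb_or c0 sqrt_neq0.
have vs' : vL (c *: s) = 1.
  by rewrite -mulr_algl valM ?A0 ?sqrt_neq0 // (vext_alg hL) // vc vs; val_lia.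
have thetaE a b : vge vL n (a%:A + b *: s) ->
    theta (1 + (a%:A + b *: s)) = psi (2%:R * (b * varpi ^- n)).
  by move=> h; rewrite halpha // /psi_ext alpha_mul.
suff j0 : j = 0 by rewrite vs j0.
apply/eqP; rewrite eq_le; apply/andP; split; rewrite leNgt; apply/negP => hj.
(* Case j > 0. For z in varpi^-1 O the element b s below has valuation at least 2(n - 1) + 2j + 1 >
   2n, so [theta] is trivial at 1 + b s, where its value is psi(z). *)
- apply: hpsi1 => z hz.
  pose b := z * varpi ^+ n / 2%:R.
  have vb : vge v (n%:Z - 1) b.
    rewrite vgeMr ?invr_eq0 // valV // v2 vgeMr ?expf_neq0 // valX // vvarpi.
    by apply: vgeW hz; val_lia.
  have hu : vge vL (2 * n)%N (0%:A + b *: s).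
    clearbody b; rewrite scale0r add0r.
    have [->|b0] := eqVneq b 0; first by rewrite scale0r vge0.
    move: vb; rewrite -mulr_algl vgeMl ?A0 // (vext_alg hL) //.
    by rewrite !vgeE ?sqrt_neq0 // vs; val_lia.
  have := thetaE 0 b; rewrite htr.
  + have -> : 2%:R * (b * varpi ^- n) = z by rewrite /b; field; rewrite two0 expf_neq0.
    by move=> <- //; apply: vgeW hu; val_lia.
  + apply/is_unitP; apply: val_near1 => //.
    by rewrite addrC addKr; apply: vgeW hu; val_lia.
  + by rewrite addrC addKr.
(* Case j < 0. On U(2n - 1) the s-coordinate has valuation at least n - 1 - j >= n, so [psi] is
   evaluated on integers and the conductor would be at most 2n - 1. *)
- have := hmin (2 * n - 1)%N; suff h : trivial_on_units vL theta (2 * n - 1).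
    by move=> /(_ h); val_lia.
  move=> x ux hx; have [a [b e]] := uniformizer_coord hv hL s'0 vs' (x - 1).
  have -> : x = 1 + (x - 1) by rewrite addrC subrK.
  have hu : vge vL n (x - 1) by apply: vgeW hx; val_lia.
  move: hx hu; rewrite e scalerA => hx hu; rewrite thetaE //; apply: hpsi0.
  move: hx; rewrite -scalerA (_ : (2 * n - 1)%N%:Z = (n%:Z - 1) *+ 2 + 1); last by val_lia.
  rewrite (vge_ext_odd hL s'0 vs') => /andP[_ vb].
  rewrite vgeMl // v2 vgeMr // vw vgeMr // vc.
  by apply: vgeW vb; val_lia.
Qed.

Lemma val_D' : v D' = 1.
Proof.
have := valX (normalized_ext hL) 2 sqrt_neq0; rewrite sqrt_sqr (vext_alg hL) ?D'_neq0 //.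
by rewrite sqrt_uniformizer; val_lia.
Qed.

End Conductor.

(** * The compactly induced representation *)

Section CompactInductionTheory.
Variables (C : numClosedFieldType) (F : fieldType) (v : F -> int).
Hypothesis hv : normalized_valuation v.
Variables (psi : F -> C) (L : fieldExtType F) (theta : L -> C) (n : nat).
Variables (alpha s : L) (D' : F).

Lemma vge_mulmx (m k : int) (X Y : 'M[F]_2) : (forall i j, vge v m (X i j)) ->
  (forall i j, vge v k (Y i j)) -> forall i j, vge v (m + k) ((X *m Y) i j).
Proof.
by move=> hX hY i j; rewrite mxE; apply: vge_sum => // l _; apply: vgeM.
Qed.

Lemma mx_bounded (X : 'M[F]_2) : exists k : nat, forall i j, vge v (- k%:Z) (X i j).
Proof.
exists (\sum_i \sum_j `|v (X i j)|)%N => i j.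
apply: vgeW (vge_val v (X i j)).
have : (`|v (X i j)| <= \sum_i \sum_j `|v (X i j)|)%N.
  by rewrite (bigD1 i) //= (bigD1 j) //= -addnA leq_addr.
by val_lia.
Qed.

Lemma smooth_cInd : smooth_rep v (cInd v psi theta n alpha s D').
Proof.
split; last 1 first.
- move=> f [_ _ _ [m m0 hm]]; exists m => // X hX.
  by apply: funext => h /=; exact: hm.
- split; first split.
  + split=> //.
    * by move=> *; rewrite mulr0.
    * by exists [::] => g; rewrite eqxx.
    * by exists 1%N.
  + move=> a f1 f2 [n1 j1 [hs1 s1] [m1 m10 h1]] [n2 j2 [hs2 s2] [m2 m20 h2]].
    have E g : (a *: f1 + f2) g = a * f1 g + f2 g by [].
    split.
    * by move=> g hg; rewrite E n1 // n2 // mulr0 addr0.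
    * by move=> j z g hj; rewrite !E (j1 _ _ _ hj) (j2 _ _ _ hj); ring.
    * exists (hs1 ++ hs2) => g.
      have [e1|/s1[j [h [hj hh ->]]] _] := eqVneq (f1 g) 0; last first.
        by exists j, h; rewrite mem_cat hh.
      rewrite E e1 mulr0 add0r => /s2[j [h [hj hh ->]]].
      by exists j, h; rewrite mem_cat hh orbT.
    * exists (maxn m1 m2); first by rewrite leq_max m10.
      move=> g X hX; rewrite !E h1 ?h2 // => i j; apply: vgeW (hX i j); val_lia.
  + move=> k f ku [hn hj [hs hss] [m m0 hm]]; split.
    * move=> g gu; apply: hn; apply: contra gu => gku.
      by rewrite -(mulmxK ku g) unitmx_mul gku unitmx_inv.
    * by move=> j z g hjz /=; rewrite -mulmxA (hj _ _ _ hjz).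
    * exists [seq h *m invmx k | h <- hs] => g /= /hss[j [h [hJ hh e]]].
      exists j, (h *m invmx k); split=> //; first exact: map_f.
      by rewrite mulmxA -e mulmxK.
    (* Translating by k replaces X by k^-1 X k, and [a] and [b] bound the denominators of k^-1 and
       k. *)
    * have [a ha] := mx_bounded (invmx k); have [b hb] := mx_bounded k.
      exists (m + a + b)%N; first by val_lia.
      move=> g X hX /=.
      have -> : g *m (1%:M + X) *m k = g *m k *m (1%:M + invmx k *m X *m k).
        by rewrite !mulmxDr !mulmx1 mulmxDl -!mulmxA (mulmxA k (invmx k)) mulmxV // mul1mx.
      apply: hm => i j.
      have := vge_mulmx (vge_mulmx ha hX) hb i j.
      by apply: vgeW; val_lia.
- by [].
- by move=> f _; apply: funext => h /=; rewrite mulmx1.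
- by move=> g h f _ _ _; apply: funext => k /=; rewrite mulmxA.
Qed.

End CompactInductionTheory.

(** * Functions in the induced space fixed by H *)

Section Newvector.
Variables (C : numClosedFieldType) (F : fieldType) (v : F -> int).
Hypothesis hv : normalized_valuation v.
Variables (varpi : F) (varpi0 : varpi != 0) (vvarpi : v varpi = 1).
Variables (n : nat) (hn : (1 <= n)%N).

(* Together with the scalars, which act trivially below, these matrices generate
   the conjugate of the congruence subgroup of level [2n + 1] by
   [diag(varpi^n, 1)]. *)
Definition balanced_fixed (pi : gl2rep C F) (x : pi) : Prop :=
  [/\ forall t, vge v 0 t -> act (mx22 1 (varpi ^+ n * t) 0 1) x = x,
      forall t, vge v 0 t -> act (mx22 1 0 (varpi ^+ n.+1 * t) 1) x = x
    & forall a, is_unit v a -> act (mx22 a 0 0 1) x = x].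

Variables (psi : F -> C) (hpsi0 : trivial_on_ideal v psi 0).
Hypothesis hpsi1 : ~ trivial_on_ideal v psi (-1).
Variables (L : fieldExtType F) (vL : L -> int).
Hypothesis hL : ramified_quadratic v vL.
Variables (theta : L -> C) (htheta1 : forall a : F, a != 0 -> theta a%:A = 1).
Variables (s : L) (D' : F) (s0 : s != 0) (vs : vL s = 1) (s2 : s ^+ 2 = D'%:A).
Hypotheses (D'0 : D' != 0) (vD' : v D' = 1).
Variables (alpha : L) (alphaE : alpha = (varpi ^- n / D')%:A * s).

Let pi := cInd v psi theta n alpha s D'.
Let ttilde := theta_tilde v psi theta n alpha s D'.

(** The image of alpha is antidiagonal, so the character of K(n) depends only on the off-diagonal
    entries. This is what makes explicit nontrivial values easy to produce. *)
Lemma tr_alpha (a b c e : F) :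
  \tr (quad_embed s D' alpha *m mx22 a b c e) = varpi ^- n * (c / D' + b).
Proof.
have -> : quad_embed s D' alpha = mx22 0 (varpi ^- n / D') (varpi ^- n) 0.
  have := quad_embedE hv hL s0 vs D' 0 (varpi ^- n / D').
  by rewrite scale0r add0r alphaE mulr_algl => ->; rewrite mulfVK.
by rewrite mulmx22 tr_mx22; ring.
Qed.

Lemma theta_tilde_lattice (a b c e : F) :
  vge v (uphalf n) a -> vge v n./2 b -> vge v n./2.+1 c -> vge v (uphalf n) e ->
  ttilde (1%:M + mx22 a b c e) (psi (varpi ^- n * (c / D' + b))).
Proof.
move=> ha hb hc he; exists 1, (mx22 a b c e); split.
- exact: oner_neq0.
- by split; rewrite mx22E.
- by rewrite -[1 in RHS]scale1r (quad_embed_alg hv hL D' s0 vs) mul1mx.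
- by rewrite tr_alpha -[X in theta X]scale1r htheta1 ?oner_neq0 // mul1r.
Qed.

Lemma psi0 : psi 0 = 1.
Proof. by apply: hpsi0; exact: vge0. Qed.

Lemma theta_tilde_torus (t : L) : t != 0 -> ttilde (quad_embed s D' t) (theta t).
Proof.
move=> t0; exists t, 0; split=> //.
- by split; rewrite mxE vge0.
- by rewrite addr0 mulmx1.
- by rewrite mulmx0 mxtrace0 psi0 mulr1.
Qed.

Lemma cInd_scalar (f : pi) (a : F) g : car pi f -> a != 0 -> f (a%:M *m g) = f g.
Proof.
move=> [_ hj _ _] a0.
have A0 : a%:A != 0 :> L by rewrite scaler_eq0 negb_or a0 oner_neq0.
have := hj _ _ g (theta_tilde_torus A0).
by rewrite (quad_embed_alg hv hL D' s0 vs) htheta1 // mul1r.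
Qed.

Lemma psi_nontrivial : exists2 z, vge v (-1) z & psi z != 1.
Proof.
apply: contrapT => h; apply: hpsi1 => z hz.
by apply/eqP/negPn/negP => nz; apply: h; exists z.
Qed.

(** Mackey's argument: if k g = g h with k in K(n) and h fixing f, then f(g) = f(g h) = f(k g) is
    f(g) times the character value at k, which is not 1. *)
Lemma cInd_vanish (f : pi) (a b c e : F) (g h : 'M[F]_2) : car pi f ->
  vge v (uphalf n) a -> vge v n./2 b -> vge v n./2.+1 c -> vge v (uphalf n) e ->
  psi (varpi ^- n * (c / D' + b)) != 1 ->
  act h f = f -> (1%:M + mx22 a b c e) *m g = g *m h -> f g = 0.
Proof.
move=> [_ hj _ _] ha hb hc he npsi hf eg.
have := hj _ _ g (theta_tilde_lattice ha hb hc he).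
rewrite eg (_ : f (g *m h) = f g); last by rewrite -{2}hf.
move/eqP; rewrite -subr_eq0 -{1}[f g]mul1r -mulrBl mulf_eq0 subr_eq0 eq_sym.
by rewrite (negPf npsi) /= => /eqP.
Qed.

Let vw k : v (varpi ^+ k) = k.
Proof. by rewrite valX // vvarpi mul1r. Qed.
Let w0 k : varpi ^+ k != 0.
Proof. exact: expf_neq0. Qed.

Lemma balanced_upper (f : pi) (b d : F) : car pi f -> balanced_fixed f -> f 1%:M = 0 ->
  d != 0 -> f (mx22 1 b 0 d) = 0.
Proof.
move=> cf [fu fl fd] f1 d0.
have [z hz nz] := psi_nontrivial.
have halves : (n = n./2 + uphalf n)%N by rewrite -{1}(odd_double_half n) uphalf_half; val_lia.
have half_lt : (n./2 < n)%N by val_lia.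
(* Case v(d) > 0, by an upper unipotent: conjugation multiplies its entry by d, which makes up for z
   being only in varpi^-1 O. *)
have [dpos|dneg] := ltP 0 (v d).
  apply: (@cInd_vanish f 0 (varpi ^+ n * z) 0 0 _ (mx22 1 (varpi ^+ n * (z * d)) 0 1)) => //;
    rewrite ?vge0 //.
  - by rewrite vgeMl // vw; apply: vgeW hz; val_lia.
  - by rewrite mul0r add0r mulKf.
  - by apply: fu; rewrite vgeMr //; apply: vgeW hz; val_lia.
  - by rewrite scalar_mx22 addmx22 !mulmx22; congr mx22; ring.
(* A lower unipotent with entry k conjugates to an element with character value psi(varpi^-n k Q /
   (d D')); k is solved so that the argument equals z. *)
pose Q := d ^+ 2 - b ^+ 2 * D'.
pose tau := z * d * D' / (varpi * Q).
pose k := varpi ^+ n.+1 * tau.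
have vd2 : v (d ^+ 2) = v d *+ 2 by rewrite valX //; val_lia.
have lower : Q != 0 -> vge v 0 tau -> vge v (uphalf n) (k * b) ->
    vge v n./2 (k * (b ^+ 2 / d)) -> vge v n./2.+1 (k * d) ->
    f (mx22 1 b 0 d) = 0.
  move=> Q0 htau h1 h2 h3.
  apply: (@cInd_vanish f (k * b) (- (k * (b ^+ 2 / d))) (k * d) (- (k * b)) _
    (mx22 1 0 k 1)) => //;
    rewrite ?vgeN //.
  - suff -> : varpi ^- n * (k * d / D' + - (k * (b ^+ 2 / d))) = z by [].
    by move: Q0; rewrite /k /tau exprS /Q => Q0; field; rewrite d0 w0 D'0 Q0 varpi0.
  - exact: fl.
  - by rewrite scalar_mx22 addmx22 !mulmx22; congr mx22; field.
have vk : Q != 0 -> vge v (n%:Z + v d - v Q) k.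
  move=> Q0; rewrite vgeMl // vw vgeMr ?invr_eq0 ?mulf_neq0 // valV ?mulf_neq0 //.
  rewrite vgeMr // vgeMr // valM // vvarpi vD'; apply: vgeW hz; val_lia.
have htau : Q != 0 -> v Q < v d -> vge v 0 tau.
  move=> Q0 lt; have := vk Q0; rewrite vgeMl // vw; apply: vgeW; val_lia.
(* If v(b) < v(d) then v(Q) = 2 v(b) + 1, and v(d) <= 0 makes this less than v(d), so that tau is
   integral. *)
have [vb|nvb] := boolP (vge v (v d) b); last first.
  have b0 : b != 0 by apply: contraNneq nvb => ->; rewrite vge0.
  move: nvb; rewrite vgeE // -ltNge => ltb.
  have b2 : - (b ^+ 2 * D') != 0 by rewrite oppr_eq0 mulf_neq0 // expf_neq0.
  have vb2 : v (- (b ^+ 2 * D')) = v b *+ 2 + 1.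
    by rewrite valN // valM ?expf_neq0 // valX // vD'; val_lia.
  have [|Q0 vQ] := val_addl hv b2 (y := d ^+ 2).
    by rewrite vgeE ?expf_neq0 // vd2 vb2; val_lia.
  rewrite addrC -/Q vb2 in Q0 vQ; have {}vk := vk Q0.
  apply: lower => //; first by apply: htau => //; val_lia.
  - by rewrite vgeMr //; apply: vgeW vk; val_lia.
  - rewrite vgeMr ?mulf_neq0 ?invr_eq0 ?expf_neq0 // valM ?invr_eq0 ?expf_neq0 //.
    by rewrite valV // valX //; apply: vgeW vk; val_lia.
  - by rewrite vgeMr //; apply: vgeW vk; val_lia.
(* If v(d) < 0 and v(b) >= v(d), then v(Q) = 2 v(d) and the lower unipotent works again. *)
have [dlt|dge] := ltP (v d) 0.
  have d20 : d ^+ 2 != 0 by rewrite expf_neq0.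
  have [|Q0 vQ] := val_addl hv d20 (y := - (b ^+ 2 * D')).
    rewrite vgeN // vd2 vgeMr // vD' addrK expr2 mulr2n; exact: vgeM.
  rewrite -/Q vd2 in Q0 vQ; have {}vk := vk Q0.
  apply: lower => //; first by apply: htau => //; val_lia.
  - by apply: vgeW (vgeM hv vk vb); val_lia.
  - rewrite mulrA vgeMr ?invr_eq0 // valV // expr2.
    by apply: vgeW (vgeM hv vk (vgeM hv vb vb)); val_lia.
  - by rewrite vgeMr //; apply: vgeW vk; val_lia.
have vd : v d = 0 by val_lia.
(* Here d is a unit. If v(b) >= floor(n/2), the matrix is K(n) times a scalar times an element of H,
   so the value is a multiple of f(1). *)
have [hb|nhb] := boolP (vge v n./2 b).
  have hbd : vge v n./2 (b / d) by rewrite vgeMr ?invr_eq0 // valV // vd oppr0 subr0.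
  have -> : mx22 1 b 0 d = (1%:M + mx22 0 (b / d) 0 0) *m (d%:M *m mx22 d^-1 0 0 1).
    by rewrite !scalar_mx22 addmx22 !mulmx22; congr mx22; field.
  have := theta_tilde_lattice (vge0 v _) hbd (vge0 v _) (vge0 v _).
  case: (cf) => _ hj _ _ /hj ->; rewrite cInd_scalar //.
  have fd1 : act (mx22 d^-1 0 0 1) f = f by apply: fd; apply: is_unitV => //; apply/is_unitP.
  have -> : f (mx22 d^-1 0 0 1) = f 1%:M by rewrite -[in RHS]fd1 /= mul1mx.
  by rewrite f1 mulr0.
have b0 : b != 0 by apply: contraNneq nhb => ->; rewrite vge0.
move: nhb vb; rewrite !vgeE // vd -ltNge => nhb vb.
(* Here 0 <= v(b) < floor(n/2), and a diagonal element of H is used. [u] makes the two contributions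
   to the upper right entry cancel; its valuation is at least n - 1 - v(b) >= ceil(n/2). *)
pose u := - (z * varpi ^+ n * d / b).
have hu : vge v (uphalf n) u.
  rewrite vgeN // vgeMr ?invr_eq0 // valV // vgeMr // vgeMr // vw vd.
  by apply: vgeW hz; val_lia.
apply: (@cInd_vanish f u (z * varpi ^+ n) 0 0 _ (mx22 (1 + u) 0 0 1)) => //; rewrite ?vge0 //.
- by rewrite vgeMr // vw; apply: vgeW hz; val_lia.
- by rewrite mul0r add0r mulrCA mulVf ?mulr1.
- apply: fd; apply/is_unitP; apply: val_near1 => //.
  by rewrite addrC addKr; apply: vgeW hu; val_lia.
- by rewrite scalar_mx22 addmx22 !mulmx22 /u; congr mx22; field.
Qed.

Lemma balanced_eq0 (f : pi) : car pi f -> balanced_fixed f -> f 1%:M = 0 -> f = 0.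
Proof.
move=> cf bf f1; apply: funext => g.
have [gu|gn] := boolP (g \in unitmx); last by case: cf => h _ _ _; rewrite h.
(* [t] is chosen so that its image has the same first column as [g]; then t^-1 g has first column
   (1, 0). *)
pose t : L := (g 0 0)%:A + (g 1 0 / D') *: s.
have et : quad_embed s D' t = mx22 (g 0 0) (g 1 0 / D') (g 1 0) (g 0 0).
  by rewrite /t (quad_embedE hv hL s0 vs) mulfVK.
have t0 : t != 0.
  apply/eqP => t0; move: et; rewrite t0 -(scale0r 1).
  rewrite (quad_embed_alg hv hL D' s0 vs) scalar_mx22 => e.
  have := congr1 (fun A : 'M[F]_2 => A 0 0) e; rewrite !mx22E => e0.
  have := congr1 (fun A : 'M[F]_2 => A 1 0) e; rewrite !mx22E => e1.
  by move: gu; rewrite unitmxE det_mx22 -e0 -e1 !mul0r mulr0 subr0 unitr0.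
pose g' := quad_embed s D' t^-1 *m g.
have gE : g = quad_embed s D' t *m g'.
  rewrite mulmxA -(quad_embedM hv hL s0 vs s2) mulfV //.
  by rewrite -[1]scale1r (quad_embed_alg hv hL D' s0 vs) mul1mx.
have col0 i : g' i 0 = (1%:M : 'M[F]_2) i 0.
  have -> : 1%:M = quad_embed s D' t^-1 *m quad_embed s D' t.
    rewrite -(quad_embedM hv hL s0 vs s2) mulVf // -[1 in RHS]scale1r.
    by rewrite (quad_embed_alg hv hL D' s0 vs).
  by rewrite et !mxE !sum_ord2 !mx22E.
have e' : g' = mx22 1 (g' 0 1) 0 (g' 1 1) by rewrite {1}[g']mx22_eta !col0 !mxE.
have d0 : g' 1 1 != 0.
  have : g' \in unitmx.
    rewrite unitmx_mul gu andbT; apply: (quad_embed_unit hv hL s0 vs s2).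
    by rewrite invr_eq0.
  by rewrite unitmxE unitfE det_mx22 !col0 !mxE /= mul1r mulr0 subr0.
have [_ hj _ _] := cf.
by rewrite gE (hj _ _ _ (theta_tilde_torus t0)) e' balanced_upper ?mulr0.
Qed.

End Newvector.

(** * Linearity of the action and of the inner product on the carrier *)

Section Unitary.
Variables (C : numClosedFieldType) (F : fieldType) (v : F -> int).
Variables (pi : gl2rep C F) (hsm : smooth_rep v pi).
Variables (ip : pi -> pi -> C) (hip : invariant_inner_product ip).
Implicit Types (x y : pi) (g h : 'M[F]_2).

Lemma car0 : car pi 0.
Proof. by case: hsm => -[[]]. Qed.

Lemma carP (a : C) x y : car pi x -> car pi y -> car pi (a *: x + y).
Proof. by case: hsm => -[[_ h] _] _ _ _ _; apply: h. Qed.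

Lemma carZ (a : C) x : car pi x -> car pi (a *: x).
Proof. by move=> cx; rewrite -[_ *: _]addr0; apply: carP => //; exact: car0. Qed.

Lemma car_act g x : g \in unitmx -> car pi x -> car pi (act g x).
Proof. by case: hsm => -[_ h] _ _ _ _; apply: h. Qed.

Lemma actP g (a : C) x y : g \in unitmx -> car pi x -> car pi y ->
  act g (a *: x + y) = a *: act g x + act g y.
Proof. by case: hsm => _ h _ _ _; apply: h. Qed.

Lemma act1 x : car pi x -> act 1%:M x = x.
Proof. by case: hsm => _ _ h _ _; apply: h. Qed.

Lemma actM g h x : g \in unitmx -> h \in unitmx -> car pi x ->
  act (g *m h) x = act g (act h x).
Proof. by case: hsm => _ _ _ h' _; apply: h'. Qed.

Lemma act0 g : g \in unitmx -> act g (0 : pi) = 0.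
Proof.
move=> gu; have := actP (-1) gu car0 car0.
by rewrite scaler0 addr0 scaleN1r addNr.
Qed.

Lemma actZ g (a : C) x : g \in unitmx -> car pi x -> act g (a *: x) = a *: act g x.
Proof.
by move=> gu cx; have := actP a gu cx car0; rewrite addr0 act0 // addr0.
Qed.

Lemma ipC x y : car pi x -> car pi y -> ip y x = (ip x y)^*.
Proof. by case: hip => _ h _ _; apply: h. Qed.

Lemma ip_act g x y : g \in unitmx -> car pi x -> car pi y ->
  ip (act g x) (act g y) = ip x y.
Proof. by case: hip => _ _ _ h; apply: h. Qed.

Lemma ipPl (a : C) x y z : car pi x -> car pi y -> car pi z ->
  ip (a *: x + y) z = a * ip x z + ip y z.
Proof. by case: hip => h _ _ _; apply: h. Qed.

Lemma ip0l x : car pi x -> ip 0 x = 0.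
Proof.
move=> cx; have := ipPl (-1) car0 car0 cx.
by rewrite scaler0 addr0 mulN1r addNr.
Qed.

Lemma ip0r x : car pi x -> ip x 0 = 0.
Proof. by move=> cx; rewrite (ipC car0) // ip0l // conjC0. Qed.

Lemma ipZl (a : C) x y : car pi x -> car pi y -> ip (a *: x) y = a * ip x y.
Proof.
by move=> cx cy; have := ipPl a cx car0 cy; rewrite addr0 ip0l // addr0.
Qed.

Lemma ipZr (a : C) x y : car pi x -> car pi y -> ip x (a *: y) = a^* * ip x y.
Proof.
move=> cx cy; rewrite (ipC (carZ a cy) cx) ipZl // rmorphM /=.
by rewrite -(ipC cy cx).
Qed.

Lemma ip_definite x : car pi x -> ip x x = 0 -> x = 0.
Proof.
move=> cx e; apply/eqP/negPn/negP => x0.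
by case: hip => _ _ h _; have := h x cx x0; rewrite e ltxx.
Qed.

Lemma car_sum (I : eqType) (r : seq I) (f : I -> pi) :
  {in r, forall i, car pi (f i)} -> car pi (\sum_(i <- r) f i).
Proof.
move=> cf; rewrite big_seq; apply: big_ind => //; first exact: car0.
by move=> x y cx cy; rewrite -[x]scale1r; exact: carP.
Qed.

Lemma act_sum (I : eqType) (r : seq I) (f : I -> pi) g : g \in unitmx ->
  {in r, forall i, car pi (f i)} ->
  act g (\sum_(i <- r) f i) = \sum_(i <- r) act g (f i).
Proof.
move=> gu; elim: r => [|i r IH] cf; first by rewrite !big_nil act0.
have cfr : {in r, forall i, car pi (f i)} by move=> j jr; apply: cf; rewrite inE jr orbT.
rewrite !big_cons -[f i]scale1r actP ?scale1r ?IH //; last exact: car_sum.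
by apply: cf; rewrite mem_head.
Qed.

Lemma ip_suml (I : eqType) (r : seq I) (f : I -> pi) y : car pi y ->
  {in r, forall i, car pi (f i)} ->
  ip (\sum_(i <- r) f i) y = \sum_(i <- r) ip (f i) y.
Proof.
move=> cy; elim: r => [|i r IH] cf; first by rewrite !big_nil ip0l.
have cfr : {in r, forall i, car pi (f i)} by move=> j jr; apply: cf; rewrite inE jr orbT.
rewrite !big_cons -[f i]scale1r ipPl ?mul1r ?scale1r ?IH //; last exact: car_sum.
by apply: cf; rewrite mem_head.
Qed.

Lemma ip_sumr (I : eqType) (r : seq I) (f : I -> pi) y : car pi y ->
  {in r, forall i, car pi (f i)} ->
  ip y (\sum_(i <- r) f i) = \sum_(i <- r) ip y (f i).
Proof.
move=> cy cf; rewrite (ipC (car_sum cf) cy) ip_suml // rmorph_sum /=.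
by apply: eq_big_seq => i ir; rewrite -ipC //; exact: cf.
Qed.

End Unitary.

(** * The translates of the minimal vector and the expansion of the newform *)

Section MinimalVector.
Variables (C : numClosedFieldType) (F : fieldType) (v : F -> int).
Hypothesis hv : normalized_valuation v.
Variables (varpi : F) (varpi0 : varpi != 0) (vvarpi : v varpi = 1).
Variables (n : nat) (hn : (1 <= n)%N).
Variables (psi : F -> C) (hpsi0 : trivial_on_ideal v psi 0).
Hypotheses (hpsi1 : ~ trivial_on_ideal v psi (-1))
  (psiD : forall x y, psi (x + y) = psi x * psi y).
Variables (L : fieldExtType F) (vL : L -> int).
Hypothesis hL : ramified_quadratic v vL.
Variables (theta : L -> C) (htheta1 : forall a : F, a != 0 -> theta a%:A = 1).
Variables (s : L) (D' : F) (s0 : s != 0) (vs : vL s = 1) (s2 : s ^+ 2 = D'%:A).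
Hypotheses (D'0 : D' != 0) (vD' : v D' = 1).
Variables (alpha : L) (alphaE : alpha = (varpi ^- n / D')%:A * s).

Let pi := cInd v psi theta n alpha s D'.
Let ttilde := theta_tilde v psi theta n alpha s D'.
Let hsm : smooth_rep v pi := smooth_cInd hv psi theta n alpha s D'.

Variables (ip : pi -> pi -> C) (hip : invariant_inner_product ip).
Variables (phi0 : pi) (cphi0 : car pi phi0) (phi0_norm : ip phi0 phi0 = 1).
Hypothesis phi0_J : forall j z, ttilde j z -> act j phi0 = z *: phi0.

Definition twist (x : F) : pi := act (mx22 x 0 0 1) phi0.

Let diag_unit (x : F) : x != 0 -> mx22 x 0 0 1 \in unitmx.
Proof. by move=> x0; apply: mx22_unit; rewrite mulr1 mul0r subr0. Qed.
Let upper_unit (b : F) : mx22 1 b 0 1 \in unitmx.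
Proof. by apply: mx22_unit; rewrite mulr1 mulr0 subr0 oner_neq0. Qed.
Let lower_unit (c : F) : mx22 1 0 c 1 \in unitmx.
Proof. by apply: mx22_unit; rewrite mulr1 mul0r subr0 oner_neq0. Qed.
Let vw k : v (varpi ^+ k) = k.
Proof. by rewrite valX // vvarpi mul1r. Qed.
Let w0 k : varpi ^+ k != 0.
Proof. exact: expf_neq0. Qed.

Lemma car_twist x : x != 0 -> car pi (twist x).
Proof. by move=> x0; apply: (car_act hsm) => //; exact: diag_unit. Qed.

Lemma twist_diag a x : a != 0 -> x != 0 -> act (mx22 a 0 0 1) (twist x) = twist (a * x).
Proof.
move=> a0 x0; rewrite -(actM hsm) ?diag_unit //.
have e : mx22 a 0 0 1 *m mx22 x 0 0 1 = mx22 (a * x) 0 0 1.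
  by rewrite mulmx22; congr mx22; ring.
by rewrite e.
Qed.

(** Moving the unipotent past diag(x, 1) divides its entry by x, so the translates are told apart by
    the characters b -> psi(varpi^-n b / x). *)
Lemma twist_upper b x : is_unit v x -> vge v n./2 b ->
  act (mx22 1 b 0 1) (twist x) = psi (varpi ^- n * (b / x)) *: twist x.
Proof.
move=> /is_unitP[x0 vx] hb; rewrite -(actM hsm) ?diag_unit //.
have -> : mx22 1 b 0 1 *m mx22 x 0 0 1 = mx22 x 0 0 1 *m mx22 1 (b / x) 0 1.
  by rewrite !mulmx22; congr mx22; field.
have hbx : vge v n./2 (b / x) by rewrite vgeMr ?invr_eq0 // valV // vx oppr0 subr0.
rewrite (actM hsm) ?diag_unit //.
have -> : mx22 1 (b / x) 0 1 = 1%:M + mx22 0 (b / x) 0 0.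
  by rewrite scalar_mx22 addmx22; congr mx22; ring.
have := theta_tilde_lattice hv psi hL htheta1 s0 vs D'0 alphaE
  (vge0 v _) hbx (vge0 v _) (vge0 v _).
by move=> /phi0_J ->; rewrite (actZ hsm) ?diag_unit // mul0r add0r.
Qed.

Lemma twist_lower c x : is_unit v x -> vge v n./2.+1 c ->
  act (mx22 1 0 c 1) (twist x) = psi (varpi ^- n * (c * x / D')) *: twist x.
Proof.
move=> /is_unitP[x0 vx] hc; rewrite -(actM hsm) ?diag_unit //.
have -> : mx22 1 0 c 1 *m mx22 x 0 0 1 = mx22 x 0 0 1 *m mx22 1 0 (c * x) 1.
  by rewrite !mulmx22; congr mx22; field.
have hcx : vge v n./2.+1 (c * x) by rewrite vgeMr // vx subr0.
rewrite (actM hsm) ?diag_unit //.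
have -> : mx22 1 0 (c * x) 1 = 1%:M + mx22 0 0 (c * x) 0.
  by rewrite scalar_mx22 addmx22; congr mx22; ring.
have := theta_tilde_lattice hv psi hL htheta1 s0 vs D'0 alphaE
  (vge0 v _) (vge0 v _) hcx (vge0 v _).
by move=> /phi0_J ->; rewrite (actZ hsm) ?diag_unit // addr0.
Qed.

(** The quotient of the two diagonal matrices lies in K(n), and the character is trivial on diagonal
    elements of K(n). *)
Lemma twist_cong x y : is_unit v x -> is_unit v y -> vge v (uphalf n) (x - y) ->
  twist x = twist y.
Proof.
move=> /is_unitP[x0 vx] /is_unitP[y0 vy] hxy.
pose u := (x - y) / y.
have hu : vge v (uphalf n) u by rewrite vgeMr ?invr_eq0 // valV // vy oppr0 subr0.
have e : mx22 x 0 0 1 = mx22 y 0 0 1 *m (1%:M + mx22 u 0 0 0).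
  by rewrite scalar_mx22 addmx22 mulmx22 /u; congr mx22; field.
have := theta_tilde_lattice hv psi hL htheta1 s0 vs D'0 alphaE
  hu (vge0 v _) (vge0 v _) (vge0 v _).
move=> /phi0_J; rewrite mul0r addr0 mulr0 (psi0 hpsi0) scale1r => h.
rewrite /twist e (actM hsm) ?diag_unit // ?h //.
have := diag_unit x0; rewrite e unitmx_mul => /andP[] //.
Qed.

Lemma twist_norm x : x != 0 -> ip (twist x) (twist x) = 1.
Proof. by move=> x0; rewrite (ip_act hip) ?diag_unit. Qed.

Lemma twist_orthogonal x y : is_unit v x -> is_unit v y ->
  ~~ vge v (uphalf n) (x - y) -> ip (twist x) (twist y) = 0.
Proof.
move=> ux uy nxy; have [[x0 vx] [y0 vy]] := (is_unitP _ _ ux, is_unitP _ _ uy).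
have xy0 : x - y != 0 by apply: contraNneq nxy => ->; rewrite vge0.
have yx0 : y - x != 0 by rewrite -opprB oppr_eq0.
have vyx : v (y - x) < uphalf n.
  by move: nxy; rewrite vgeE // -opprB valN // -ltNge.
have [z hz nz] := psi_nontrivial hpsi1.
(* Chosen so that varpi^-n (b/x - b/y) = z, with psi(z) different from 1. The bound v(y - x) <
   ceil(n/2) puts b in varpi^floor(n/2) O. *)
pose b := z * varpi ^+ n * x * y / (y - x).
have halves : (n = n./2 + uphalf n)%N by rewrite -{1}(odd_double_half n) uphalf_half; val_lia.
have hb : vge v n./2 b.
  rewrite vgeMr ?invr_eq0 // valV // vgeMr // vgeMr // vgeMr // vw vx vy.
  by apply: vgeW hz; val_lia.
have [cx cy] := (car_twist x0, car_twist y0).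
have h (a c : F) : is_unit v a -> is_unit v c -> ip (twist a) (twist c) =
    psi (varpi ^- n * (b / a)) * (psi (varpi ^- n * (b / c)))^* * ip (twist a) (twist c).
  move=> ua uc; have [[a0 _] [c0 _]] := (is_unitP _ _ ua, is_unitP _ _ uc).
  have [ca cc] := (car_twist a0, car_twist c0).
  rewrite -{1}(ip_act hip (upper_unit b)) // !twist_upper //.
  by rewrite (ipZl hsm hip) ?(ipZr hsm hip) ?mulrA //; exact: (carZ hsm).
(* The diagonal instance shows that the eigenvalue at y has absolute value 1; unitarity of [psi] is
   not among the hypotheses. *)
have hy := h _ _ uy uy; rewrite twist_norm // mulr1 in hy.
apply/eqP/negPn/negP => ne; case/negP: nz; apply/eqP.
have := h _ _ ux uy; rewrite -{1}[ip _ _]mul1r => /(mulIf ne) => hx.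
have exy : psi (varpi ^- n * (b / x)) = psi (varpi ^- n * (b / y)).
  apply: (@mulIf _ (psi (varpi ^- n * (b / y)))^*); last by rewrite -hx -hy.
  by apply/eqP => e0; move/eqP: hy; rewrite e0 mulr0 oner_eq0.
have py0 : psi (varpi ^- n * (b / y)) != 0.
  by apply/eqP => e0; move/eqP: hy; rewrite e0 mul0r oner_eq0.
apply: (mulIf py0); rewrite mul1r -psiD -exy; congr psi.
by rewrite /b; field; rewrite w0 x0 yx0 y0.
Qed.

Section NewvectorExpansion.
Variables (tr : seq F) (htr : transversal (is_unit v) (cong v (uphalf n)) tr).

Definition twist_sum : pi := \sum_(x <- tr) twist x.

Let tr_unit x : x \in tr -> is_unit v x.
Proof. by case: htr => h _ _ /h. Qed.
Let tr_neq0 x : x \in tr -> x != 0.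
Proof. by move=> /tr_unit /is_unitP[]. Qed.
Let ctr : {in tr, forall x, car pi (twist x)}.
Proof. by move=> x /tr_neq0; exact: car_twist. Qed.

Lemma car_twist_sum : car pi twist_sum.
Proof. exact: (car_sum hsm). Qed.

(** Entries in varpi^n O (upper) or varpi^(n+1) O (lower) make every eigenvalue a value of [psi] on
    integers, so each translate is fixed separately. A diagonal unit only permutes the
    translates. *)
Lemma twist_sum_balanced : balanced_fixed v varpi n twist_sum.
Proof.
split=> [t ht|t ht|a /is_unitP[a0 va]].
- rewrite (act_sum hsm) //; apply: eq_big_seq => x xtr.
  have ux := tr_unit xtr; have [x0 vx] := is_unitP _ _ ux.
  rewrite twist_upper //; last by rewrite vgeMl // vw; apply: vgeW ht; val_lia.
  rewrite hpsi0 ?scale1r // mulrA mulKf // vgeMr ?invr_eq0 // valV // vx.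
  by apply: vgeW ht; val_lia.
- rewrite (act_sum hsm) //; apply: eq_big_seq => x xtr.
  have ux := tr_unit xtr; have [x0 vx] := is_unitP _ _ ux.
  rewrite twist_lower //; last by rewrite vgeMl // vw; apply: vgeW ht; val_lia.
  rewrite hpsi0 ?scale1r // exprSr.
  have -> : varpi ^- n * (varpi ^+ n * varpi * t * x / D') = varpi * t * x / D'.
    by field; rewrite D'0 w0.
  rewrite vgeMr ?invr_eq0 // valV // vD' vgeMr // vx vgeMl // vvarpi.
  by apply: vgeW ht; val_lia.
- rewrite (act_sum hsm) ?diag_unit //.
  rewrite (eq_big_seq (fun x => twist (a * x))); last first.
    by move=> x /tr_neq0 x0; rewrite twist_diag.
  rewrite -(big_map (fun x => a * x) predT twist).
  have ua : is_unit v a by apply/is_unitP.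
  have r_refl : {in is_unit v, forall x, cong v (uphalf n) x x}.
    by move=> x _; exact: cong_refl.
  have r_sym : {in is_unit v &, forall x y, cong v (uphalf n) x y -> cong v (uphalf n) y x}.
    by move=> x y _ _; rewrite cong_sym.
  have r_trans : {in is_unit v & &, forall x y z, cong v (uphalf n) x y ->
      cong v (uphalf n) y z -> cong v (uphalf n) x z}.
    by move=> x y z _ _ _; exact: cong_trans.
  apply: (transversal_sum r_refl r_sym r_trans) htr => [x y ux uy|]; first exact: twist_cong.
  apply: (@transversal_map _ _ _ r_refl r_sym r_trans
    (fun x => a * x) (fun x => a^-1 * x)) htr _ _ _ _.
  + by move=> x ux; apply: is_unitM.
  + by move=> x ux; apply: is_unitM => //; apply: is_unitV.
  + move=> x y ux uy; rewrite /cong.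
    have -> : a * x - y = a * (x - a^-1 * y) by field.
    by rewrite vgeMl // va subr0.
  + by move=> x ux; rewrite mulKf // cong_refl.
Qed.

Lemma twist_sum_norm : ip twist_sum twist_sum = (size tr)%:R.
Proof.
have cS := car_twist_sum; rewrite {1}/twist_sum (ip_suml hsm hip) //.
rewrite (eq_big_seq (fun=> 1)); first by rewrite big_const_seq count_predT iter_addr_0.
move=> x xtr; rewrite (ip_sumr hsm hip (ctr xtr) ctr).
have r_refl : {in is_unit v, forall x, cong v (uphalf n) x x}.
  by move=> y _; exact: cong_refl.
have r_sym : {in is_unit v &, forall x y, cong v (uphalf n) x y -> cong v (uphalf n) y x}.
  by move=> y z _ _; rewrite cong_sym.
rewrite (bigD1_seq x xtr (transversal_uniq r_refl htr)) /=.
rewrite twist_norm ?tr_neq0 // big_seq_cond big1 ?addr0 // => y /andP[ytr nyx].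
apply: twist_orthogonal; rewrite ?tr_unit //; apply: contra nyx => h.
by apply/eqP/esym; apply: (transversal_inj r_sym htr).
Qed.

(** With [K1_balanced], this passes between K1-fixed and H-fixed vectors; it provides the upper
    bound on the conductor. *)
Lemma balanced_K1 (x : pi) : car pi x -> balanced_fixed v varpi n x ->
  fixed_by_K1 v (2 * n + 1) (act (mx22 (varpi ^- n) 0 0 1) x).
Proof.
move=> cx [xu xl xd] g /and4P[/forallP gO /andP[dg0 /eqP vdg] gc gd].
have hO i j : vge v 0 (g i j) by have /forallP := gO i; apply.
have [d0 vd] : g 1 1 != 0 /\ v (g 1 1) = 0 by apply: val_near1 => //; apply: vgeW gd; val_lia.
have wV0 : varpi ^- n != 0 by rewrite invr_eq0.
have gu : g \in unitmx by rewrite unitmxE unitfE.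
move: dg0 vdg gu; rewrite det_mx22 [g]mx22_eta !mx22E.
move: (g 0 0) (g 0 1) (g 1 0) (g 1 1) (hO 0 1) gc d0 vd => a b c d vb vc d0 vd det0 vdet gu.
rewrite -(actM hsm) ?diag_unit //.
(* Iwahori factorization, possible because d is a unit. The scalar d is split off so that each
   remaining torus or unipotent factor is one of the three types in [balanced_fixed]. *)
have -> : mx22 a b c d *m mx22 (varpi ^- n) 0 0 1 = mx22 (varpi ^- n) 0 0 1 *m
    (mx22 1 (varpi ^+ n * (b / d)) 0 1 *m (d%:M *m (mx22 ((a * d - b * c) / d ^+ 2) 0 0 1 *m
     mx22 1 0 (varpi ^+ n.+1 * (varpi ^- (2 * n + 1) * c / d)) 1))).
  rewrite scalar_mx22 !mulmx22 mul2n -addnn addn1 -addSn exprD exprS; congr mx22; field;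
    by rewrite ?w0 ?varpi0 ?d0.
have du : (d%:M : 'M[F]_2) \in unitmx.
  by rewrite scalar_mx22; apply: mx22_unit; rewrite mulr0 subr0 mulf_neq0.
have e0 : (a * d - b * c) / d ^+ 2 != 0 by rewrite mulf_neq0 // invr_eq0 expf_neq0.
have d2u : mx22 ((a * d - b * c) / d ^+ 2) 0 0 1 \in unitmx by exact: diag_unit.
have dact y : car pi y -> act d%:M y = y.
  move=> cy; apply: funext => h /=.
  by rewrite scalar_mxC (cInd_scalar hv hpsi0 hL htheta1 s0 vs).
have H1 : is_unit v ((a * d - b * c) / d ^+ 2).
  apply/is_unitP; split=> //.
  by rewrite valM ?invr_eq0 ?expf_neq0 // valV ?expf_neq0 // valX // vdet vd.
have H2 : vge v 0 (varpi ^- (2 * n + 1) * c / d).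
  rewrite vgeMr ?invr_eq0 // valV // vd vgeMl ?invr_eq0 // valV // vw.
  by apply: vgeW vc; val_lia.
have H3 : vge v 0 (b / d) by rewrite vgeMr ?invr_eq0 // valV // vd.
rewrite (actM hsm) ?diag_unit ?unitmx_mul ?upper_unit ?du ?d2u ?lower_unit //.
rewrite !(actM hsm) ?unitmx_mul ?upper_unit ?du ?d2u ?lower_unit //.
by rewrite xl // xd // dact // xu.
Qed.

Lemma K1_balanced (c : nat) (x : pi) : (c <= 2 * n + 1)%N -> car pi x ->
  fixed_by_K1 v c x -> balanced_fixed v varpi n (act (mx22 (varpi ^+ n) 0 0 1) x).
Proof.
move=> hc cx fx.
have du : mx22 (varpi ^+ n) 0 0 1 \in unitmx by exact: diag_unit.
(* The condition b e = 0 makes the determinant a, which covers the three types of generators at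
   once. *)
have K1fix a b e : is_unit v a -> vge v 0 b -> vge v (2 * n + 1)%N e -> b * e = 0 ->
    act (mx22 a b e 1) x = x.
  move=> /is_unitP[a0 va] vb ve be; apply: fx; rewrite /K1 det_mx22 !mx22E mulr1 be !subr0.
  apply/and4P; split.
  - apply/forallP => i; apply/forallP => j.
    case: (ord2P i) => ->; case: (ord2P j) => ->; rewrite mx22E ?vge_val //.
    + by rewrite vgeE // va.
    + by apply: vgeW ve.
    + by rewrite vgeE ?oner_neq0 // val1.
  - by apply/is_unitP.
  - by apply: vgeW ve; val_lia.
  - by rewrite subrr vge0.
have fixed h h' : h \in unitmx -> h' \in unitmx -> act h' x = x ->
    h *m mx22 (varpi ^+ n) 0 0 1 = mx22 (varpi ^+ n) 0 0 1 *m h' ->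
    act h (act (mx22 (varpi ^+ n) 0 0 1) x) = act (mx22 (varpi ^+ n) 0 0 1) x.
  by move=> hu hu' hx e; rewrite -(actM hsm) // e (actM hsm) // hx.
split=> [t ht|t ht|a ua].
- apply: (fixed _ (mx22 1 t 0 1)) => //; first by apply: K1fix; rewrite ?mulr0 ?vge0 ?is_unit1.
  by rewrite !mulmx22; congr mx22; ring.
- apply: (fixed _ (mx22 1 0 (varpi ^+ (2 * n + 1) * t) 1)) => //.
    apply: K1fix; rewrite ?mul0r ?vge0 ?is_unit1 // vgeMl // vw.
    by apply: vgeW ht; val_lia.
  by rewrite !mulmx22 mul2n -addnn addn1 -addSn exprD; congr mx22; ring.
- have [a0 _] := is_unitP _ _ ua.
  apply: (fixed _ (mx22 a 0 0 1)) => //; try exact: diag_unit.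
    by apply: K1fix; rewrite ?mul0r ?vge0.
  by rewrite !mulmx22; congr mx22; ring.
Qed.

(** Evaluation at the identity is injective on H-fixed vectors, so they form at most a line, spanned
    by the sum of the translates; comparing norms fixes the absolute value of the coefficient. *)
Lemma newvector_expansion (x : pi) : (0 < size tr)%N -> car pi x -> ip x x = 1 ->
  fixed_by_K1 v (rep_conductor v pi) x ->
  exists2 c : C, act (mx22 (varpi ^+ n) 0 0 1) x = c *: twist_sum
    & c * c^* = (size tr)%:R^-1.
Proof.
move=> tr0 cx nx fx; have cS := car_twist_sum; have bS := twist_sum_balanced.
have N0 : (size tr)%:R != 0 :> C by rewrite pnatr_eq0 -lt0n.
have S1 : twist_sum 1%:M != 0.
  apply: contra N0 => /eqP S1; rewrite -twist_sum_norm.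
  rewrite (balanced_eq0 hv varpi0 vvarpi hn hpsi0 hpsi1 hL htheta1 s0 vs s2 D'0
    vD' alphaE cS bS S1).
  by rewrite (ip0l hsm hip) //; exact: (car0 hsm).
(* The translated sum is a nonzero vector fixed at level 2n + 1, so the minimum defining the
   conductor exists and is at most 2n + 1. *)
have hcond : (rep_conductor v pi <= 2 * n + 1)%N.
  have ex : has_K1_fixed v pi (2 * n + 1).
    exists (act (mx22 (varpi ^- n) 0 0 1) twist_sum).
    have du : mx22 (varpi ^- n) 0 0 1 \in unitmx by apply: diag_unit; rewrite invr_eq0.
    split; [exact: (car_act hsm) | | exact: balanced_K1].
    apply: contra N0 => /eqP e0; rewrite -twist_sum_norm -(ip_act hip du) // e0.
    by rewrite (ip0l hsm hip) //; exact: (car0 hsm).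
  by have [_] := xget_least (ex_intro _ _ ex); apply.
have du : mx22 (varpi ^+ n) 0 0 1 \in unitmx by exact: diag_unit.
have := K1_balanced hcond cx fx.
have cy : car pi (act (mx22 (varpi ^+ n) 0 0 1) x) by exact: (car_act hsm).
have := ip_act hip du cx cx; rewrite nx.
move: (act _ x) cy => y cy ny [yu yl yd]; have [Su Sl Sd] := bS.
pose c := y 1%:M / twist_sum 1%:M.
have ey : y = c *: twist_sum.
  apply/eqP; rewrite -subr_eq0 addrC -scaleNr; apply/eqP.
  apply: (balanced_eq0 hv varpi0 vvarpi hn hpsi0 hpsi1 hL htheta1 s0 vs s2 D'0 vD' alphaE).
  - exact: (carP hsm).
  - split=> [t ht|t ht|a ua]; last have [a0 _] := is_unitP _ _ ua.
    + by rewrite (actP hsm) ?upper_unit // yu // Su.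
    + by rewrite (actP hsm) ?lower_unit // yl // Sl.
    + by rewrite (actP hsm) ?diag_unit // yd // Sd.
  - by rewrite -[LHS]/(- c * twist_sum 1%:M + y 1%:M) /c mulNr mulfVK // addNr.
exists c => //; move: ny; rewrite ey (ipZl hsm hip) // ?(ipZr hsm hip) //.
  by rewrite twist_sum_norm => e; apply: (mulIf N0); rewrite mulVf // -mulrA.
exact: (carZ hsm).
Qed.

End NewvectorExpansion.

End MinimalVector.

(** * Integration over cosets and the period *)

Section UnitGroups.
Variables (K : fieldType) (v : K -> int).
Hypothesis hv : normalized_valuation v.
Variables (m : nat) (m0 : (0 < m)%N).

Lemma near1_unit x : vge v m (x - 1) -> x != 0 /\ v x = 0.
Proof. by move=> h; apply: val_near1 => //; apply: vgeW h; val_lia. Qed.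

Lemma near1M x y : vge v m (x - 1) -> vge v m (y - 1) -> vge v m (x * y - 1).
Proof.
move=> hx hy; have [y0 vy] := near1_unit hy.
have -> : x * y - 1 = (x - 1) * y + (y - 1) by ring.
by apply: vgeD => //; rewrite vgeMr // vy subr0.
Qed.

Lemma near1V x : vge v m (x - 1) -> vge v m (x^-1 - 1).
Proof.
move=> hx; have [x0 vx] := near1_unit hx.
have -> : x^-1 - 1 = - (x - 1) / x by field.
by rewrite vgeMr ?invr_eq0 // valV // vx oppr0 subr0 vgeN.
Qed.

End UnitGroups.

(** * Finitely many cosets of F^* U_E(m) in E^*, and their measure *)

Section ProjectiveCosets.
Variables (F : fieldType) (v : F -> int) (E : fieldExtType F) (vE : E -> int).
Hypotheses (hv : normalized_valuation v) (hE : ramified_quadratic v vE).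
Variables (m : nat) (m0 : (0 < m)%N).
Let hvE := normalized_ext hE.

(** Equality in E^* / F^* U_E(m). The scalar is existentially quantified, hence the classical
    boolean. *)
Definition same_coset : rel E := fun t u =>
  `[< exists2 a : F, a != 0 & vge vE m (a *: (t / u) - 1) >].

Let A : pred E := fun t => t != 0.

Lemma same_coset_refl : {in A, forall t, same_coset t t}.
Proof.
move=> t t0; apply/asboolP; exists 1; first exact: oner_neq0.
by rewrite mulfV // scale1r subrr vge0.
Qed.

Lemma same_coset_trans :
  {in A & A & A, forall t u w, same_coset t u -> same_coset u w -> same_coset t w}.
Proof.
move=> t u w _ u0 _ /asboolP[a a0 ha] /asboolP[b b0 hb]; apply/asboolP.
exists (a * b); first exact: mulf_neq0.
have -> : (a * b) *: (t / w) = a *: (t / u) * (b *: (u / w)).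
  by rewrite -scalerAl -scalerAr scalerA mulrA mulfVK.
exact: near1M.
Qed.

Lemma same_coset_sym : {in A &, forall t u, same_coset t u -> same_coset u t}.
Proof.
move=> t u t0' u0' /asboolP[a a0 ha]; apply/asboolP.
have [t0 u0] : t != 0 /\ u != 0 by [].
exists a^-1; first by rewrite invr_eq0.
have -> : a^-1 *: (u / t) = (a *: (t / u))^-1 
  by rewrite invrZ ?unitfE ?mulf_neq0 ?invr_eq0 // invfM invrK mulrC.
exact: near1V.
Qed.

Lemma same_coset_mul (z t u : E) : z != 0 -> same_coset (z * t) (z * u) = same_coset t u.
Proof.
move=> z0; rewrite /same_coset.
by have -> : z * t / (z * u) = t / u by rewrite invfM mulrACA mulfV // mul1r.
Qed.

Variables (varpi : F) (varpi0 : varpi != 0) (vvarpi : v varpi = 1).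
Variables (q : nat) (digits : seq F).
Hypotheses (hdig : transversal (vge v 0) (cong v 1) digits) (sdig : size digits = q).
Variables (s : E) (s0 : s != 0) (vs : vE s = 1).

(** Compactness of F^* \ E^* made explicit: up to a scalar, every element is 1 + y s or x + s with
    x, y integral, and these coordinates matter only modulo varpi^m. *)
Lemma coset_transversal : exists T, transversal A same_coset T.
Proof.
have [Y [YO _ Ycov] _] := integer_transversal hv varpi0 vvarpi hdig sdig m.
have A1 (y : F) : 1 + y *: s != 0.
  apply/eqP => e; have := vge_ext_even hE s0 vs 1 y 1.
  by rewrite scale1r e vge0 => /esym/andP[]; rewrite vgeE ?oner_neq0 // val1.
have A2 (x : F) : x%:A + s != 0.
  apply/eqP => e; have := vge_ext_even hE s0 vs x 1 1.
  by rewrite scale1r e vge0 => /esym/andP[_]; rewrite vgeE ?oner_neq0 // val1.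
apply: (transversal_cover (r := same_coset) (A := A) same_coset_refl same_coset_trans
  (s0 := [seq 1 + y *: s | y <- Y] ++ [seq x%:A + s | x <- Y])).
  by move=> t; rewrite mem_cat => /orP[] /mapP[y _ ->]; [exact: A1 | exact: A2].
move=> t t0'; have t0 : t != 0 by [].
have [x [y et]] := uniformizer_coord hv hE s0 vs t.
have small z w : z != 0 -> vge vE m ((w - z) / z) -> vge vE m (w / z - 1).
  by move=> z0; rewrite mulrBl mulfV.
have [hxy|hyx] := boolP ((x != 0) && vge v 0 (y / x)).
  have [x0 hy] := andP hxy; have /hasP[y' y'Y ry] := Ycov _ hy.
  apply/hasP; exists (1 + y' *: s); first by rewrite mem_cat (map_f (fun y => 1 + y *: s)).
  apply/asboolP; exists x^-1; first by rewrite invr_eq0.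
  rewrite scalerAl; apply: small; first exact: A1.
  have -> : x^-1 *: t - (1 + y' *: s) = (y / x - y') *: s.
    rewrite et scalerDr !scalerA mulVf // scale1r opprD addrACA subrr add0r.
    by rewrite -scalerBl mulrC.
  (* The coordinate 1 bounds the valuation, so dividing by this element cannot reduce precision. *)
  have v1 : vE (1 + y' *: s) <= 0.
    rewrite leNgt; apply/negP => h1.
    have : vge vE (0 *+ 2 + 1) (1%:A + y' *: s).
      by rewrite scale1r vgeE ?A1 // mul0rn add0r -gtz0_ge1.
    by rewrite (vge_ext_odd hE s0 vs) vgeE ?oner_neq0 // (val1 hv).
  rewrite vgeMr ?invr_eq0 // valV //.
  move: ry; rewrite /cong -(vge_alg hE) => ry.
  rewrite -[X in vge _ _ X]mulr_algl (vgeMr hvE _ _ s0) vs.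
  by apply: vgeW ry; val_lia.
have y0 : y != 0.
  apply: contra hyx => /eqP y0; move: t0; rewrite et y0 scale0r addr0 mul0r vge0 andbT.
  by apply: contraNneq => ->; rewrite scale0r.
have hx : vge v 0 (x / y).
  have [->|x0] := eqVneq x 0; first by rewrite mul0r vge0.
  move: hyx; rewrite x0 /= !vgeMr ?invr_eq0 // !valV // !vgeE //; lia.
have /hasP[x' x'Y rx] := Ycov _ hx.
apply/hasP; exists (x'%:A + s); first by rewrite mem_cat (map_f (fun x => x%:A + s)) ?orbT.
apply/asboolP; exists y^-1; first by rewrite invr_eq0.
rewrite scalerAl; apply: small; first exact: A2.
have -> : y^-1 *: t - (x'%:A + s) = (x / y - x')%:A.
  rewrite et scalerDr !scalerA mulVf // scale1r opprD addrACA subrr addr0.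
  by rewrite -scalerBl mulrC.
(* Division may cost one unit of precision here, and 2m - 1 >= m absorbs it. *)
have v1 : vE (x'%:A + s) <= 1.
  rewrite leNgt; apply/negP => h1.
  have : vge vE (1 *+ 2) (x'%:A + 1 *: s).
    by rewrite scale1r vgeE ?A2 //; lia.
  by rewrite (vge_ext_even hE s0 vs) => /andP[_]; rewrite vgeE ?oner_neq0 // (val1 hv).
rewrite vgeMr ?invr_eq0 // valV //.
by move: rx; rewrite /cong -(vge_alg hE) => rx; apply: vgeW rx; val_lia.
Qed.

Section Integral.
Variables (R : realType) (mu : {measure set (EmodF vE) -> \bar R}).
Hypothesis hmu : normalized_haar mu.

Definition coset (t : E) : set (EmodF vE) := [set u : E | u != 0 /\ same_coset u t].

Lemma open_measurable_EmodF (B : set (EmodF vE)) : quotient_open vE B -> measurable B.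
Proof. by move=> h; exact: sub_sigma_algebra. Qed.

Lemma coset_measurable t : measurable (coset t).
Proof.
apply: open_measurable_EmodF; split=> [u []//|a u a0 [u0 /asboolP[b b0 hb]]|].
  split; first by rewrite scaler_eq0 negb_or a0.
  apply/asboolP; exists (b / a); first by rewrite mulf_neq0 ?invr_eq0.
  by rewrite -scalerAl scalerA mulfVK.
move=> u [u0 /asboolP[b b0 hb]]; exists m => // h hh.
have [h0 vh] := near1_unit hvE m0 hh; split; first exact: mulf_neq0.
apply/asboolP; exists b => //.
have -> : b *: (u * h / t) = b *: (u / t) * h by rewrite -scalerAl mulrAC.
exact: near1M.
Qed.

(** Invariance makes all cosets equally large; the coset of 1 lies in the image of O_E^*, of measure
    1, so the value is finite. *)
Lemma coset_measure : exists2 w : R, 0 <= w & forall t, t != 0 -> mu (coset t) = w%:E.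
Proof.
have [haar one] := hmu.
have eq1 t : t != 0 -> mu (coset t) = mu (coset 1).
  move=> t0; rewrite -(haar t (coset 1) t0 (coset_measurable 1)); congr (mu _).
  apply/seteqP; split=> u.
    move=> [u0 h]; exists (t^-1 * u); last by rewrite mulVKf.
    split; first by rewrite mulf_neq0 ?invr_eq0.
    by rewrite -(same_coset_mul _ _ t0) mulVKf // mulr1.
  move=> [u' [u'0 h] <-]; split; first exact: mulf_neq0.
  by rewrite -{2}[t]mulr1 same_coset_mul.
have le1 : (mu (coset 1) <= 1)%E.
  rewrite -one; apply: le_measure; rewrite ?inE; first exact: coset_measurable.
    apply: open_measurable_EmodF; split.
    - move=> _ [a [u [a0 /is_unitP[u0 _] ->]]]; by rewrite scaler_eq0 negb_or a0.
    - move=> b _ b0 [a [u [a0 uu ->]]]; exists (b * a), u.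
      by rewrite mulf_neq0 // scalerA.
    - move=> _ [a [u [a0 uu ->]]]; exists 1%N => // h hh; exists a, (u * h).
      by rewrite scalerAl; split=> //; apply: is_unitM => //; apply/is_unitP; apply: val_near1.
  move=> u [u0 /asboolP[a a0]]; rewrite divr1 => ha.
  exists a^-1, (a *: u); rewrite invr_eq0 scalerA mulVf // scale1r; split=> //.
  by apply/is_unitP; apply: near1_unit ha.
have fin : mu (coset 1) \is a fin_num.
  by rewrite ge0_fin_numE ?measure_ge0 //; apply: le_lt_trans le1 _; rewrite ltry.
exists (fine (mu (coset 1))); first by rewrite fine_ge0.
by move=> t t0; rewrite eq1 // fineK.
Qed.

End Integral.

End ProjectiveCosets.
Arguments coset {F E} vE m t.

Section CosetIntegral.
Variables (F : fieldType) (v : F -> int) (E : fieldExtType F) (vE : E -> int).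
Hypotheses (hE : ramified_quadratic v vE).
Variables (m : nat) (m0 : (0 < m)%N).
Let hvE := normalized_ext hE.
Variables (R : realType) (mu : {measure set (EmodF vE) -> \bar R}).


Variables (T : seq E) (hT : transversal (fun t => t != 0) (same_coset vE m) T).
Variables (w : R) (hw : forall t : E, t != 0 -> mu (coset vE m t) = w%:E).

Lemma Rintegral_cosets (g : E -> R) :
  (forall t u : E, t != 0 -> u != 0 -> same_coset vE m t u -> g t = g u) ->
  (\int[mu]_(t in [set t : E | t != 0 : bool]) g t) = \sum_(t <- T) (w * g t).
Proof.
move=> gr; have [T0 _ Tcov] := hT.
have Duni : [set t : E | t != 0] = \big[setU/set0]_(t <- T) coset vE m t :> set (EmodF vE).
  rewrite -bigcup_seq; apply/seteqP; split=> [u u0|u [t _ []] //].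
  by have /hasP[t tT ut] := Tcov u u0; exists t => //; split.
have Tuniq : uniq T by exact: (transversal_uniq (@same_coset_refl F E vE m) hT).
pose D : set (EmodF vE) := [set t : E | t != 0].
(* Any preimage is a union of cosets, hence open. *)
have gmeas : @measurable_fun _ _ (EmodF vE) (\bar R) D (fun t => (g t)%:E).
  move=> _ Y mY; apply: open_measurable_EmodF; split=> [t []//|a t a0 [t0 gt]|t [t0 gt]].
    have at0 : a *: t != 0 by rewrite scaler_eq0 negb_or a0.
    split=> //=; rewrite (gr _ t) //; apply/asboolP; exists a^-1; first by rewrite invr_eq0.
    by rewrite -scalerAl scalerA mulVf // scale1r mulfV // subrr vge0.
  exists m => // u hu; have [u0 _] := near1_unit hvE m0 hu.
  have tu0 : t * u != 0 by exact: mulf_neq0.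
  split=> //=; rewrite (gr _ t) //; apply/asboolP; exists 1; first exact: oner_neq0.
  by rewrite scale1r mulrAC mulfV // mul1r.
rewrite /Rintegral Duni integral_bigsetU_EFin //; last 3 first.
- exact: (coset_measurable hE m0).
- apply/trivIsetP => t u /= tT uT /eqP ntu; apply/seteqP; split=> // z [[z0 zt] [_ zu]].
  apply: ntu; apply: (transversal_inj (same_coset_sym hE m0) hT) => //.
  have [t0 u0] := (T0 _ tT, T0 _ uT).
  apply: (same_coset_trans hE m0) zu => //.
  by apply: (same_coset_sym hE m0).
- by rewrite -Duni.
rewrite (eq_big_seq (fun t => (w * g t)%:E)) ?sumEFin // => t tT.
have t0 := T0 _ tT.
rewrite (eq_integral (cst (g t)%:E)); last first.
  by move=> u; rewrite inE => -[u0 ut]; rewrite (gr u t).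
rewrite integral_cst; last exact: (coset_measurable hE m0).
rewrite (hw t0).
by rewrite -EFinM mulrC.
Qed.

Lemma complex_integral_cosets (f : E -> R[i]) :
  (forall t u : E, t != 0 -> u != 0 -> same_coset vE m t u -> f t = f u) ->
  complex_integral mu f = Complex w 0 * \sum_(t <- T) f t.
Proof.
move=> fr; rewrite /complex_integral !Rintegral_cosets; first last.
- by move=> t u t0 u0 tu; rewrite (fr t u).
- by move=> t u t0 u0 tu; rewrite (fr t u).
elim: T => [|t r IH]; first by rewrite !big_nil mulr0.
rewrite !big_cons mulrDr -IH; case: (f t) => a b.
by apply/eqP; rewrite eq_complex /= !mul0r subr0 addr0 !eqxx.
Qed.

End CosetIntegral.

(** * The period as a Gram form *)

Section PeriodGram.
Variables (R : realType) (F : fieldType) (v : F -> int).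
Hypothesis hv : normalized_valuation v.
Variables (varpi : F) (varpi0 : varpi != 0) (vvarpi : v varpi = 1).
Variables (q : nat) (digits : seq F).
Hypotheses (hdig : transversal (vge v 0) (cong v 1) digits) (sdig : size digits = q).
Variables (E : fieldExtType F) (vE : E -> int) (hE : ramified_quadratic v vE).
Variables (D : F) (s : E).
Hypotheses (s0 : s != 0) (vs : vE s = 1) (s2 : s ^+ 2 = D%:A) (vD : v D = 1).
Variables (chi : E -> R[i]) (hchi : mult_character vE chi).
Hypothesis hchi1 : forall a : F, a != 0 -> chi a%:A = 1.
Variables (pi : gl2rep (R[i] : numClosedFieldType) F) (hsm : smooth_rep v pi).
Hypothesis pi_central : forall (a : F) (x : pi), a != 0 -> car pi x -> act a%:M x = x.
Variables (ip : pi -> pi -> R[i]) (hip : invariant_inner_product ip).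
Variables (mu : {measure set (EmodF vE) -> \bar R}) (hmu : normalized_haar mu).

Let hvE := normalized_ext hE.
Let emb := quad_embed s D.

Let emb_unit t : t != 0 -> emb t \in unitmx.
Proof. exact: (quad_embed_unit hv hE s0 vs s2). Qed.

Let embM t u : emb (t * u) = emb t *m emb u.
Proof. exact: (quad_embedM hv hE s0 vs s2). Qed.

Definition fixed_level (m : nat) (x : pi) : Prop :=
  forall X : 'M[F]_2, (forall i j, vge v m (X i j)) -> act (1%:M + X) x = x.

Lemma common_level (xs : seq pi) (k : nat) : {in xs, forall x, car pi x} ->
  exists2 m : nat, (k <= m)%N & {in xs, forall x, fixed_level m x}.
Proof.
elim: xs => [|x xs IH] cx; first by exists k.
have [y yxs|m km hm] := IH; first by apply: cx; rewrite inE yxs orbT.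
have [m' _ hm'] : exists2 m : nat, (0 < m)%N & fixed_level m x.
  by case: hsm => _ _ _ _; apply; apply: cx; rewrite mem_head.
exists (maxn m m'); first by lia.
move=> y; rewrite inE => /orP[/eqP->|yxs] X hX.
  by apply: hm' => i j; apply: vgeW (hX i j); lia.
by apply: (hm _ yxs) => i j; apply: vgeW (hX i j); lia.
Qed.

(** For [T] representing the cosets at a level that fixes x, this is |T| times the projection of x
    to the chi^-1-isotypic part. *)
Definition chi_project (T : seq E) (x : pi) : pi :=
  \sum_(t <- T) chi t *: act (emb t) x.

Lemma car_chi_project T x : {in T, forall t, t != 0} -> car pi x ->
  car pi (chi_project T x).
Proof.
move=> T0 cx; apply: (car_sum hsm) => t /T0 t0.
by apply: (carZ hsm); apply: (car_act hsm) => //; exact: emb_unit.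
Qed.

Lemma chi_projectZ T a x : {in T, forall t, t != 0} -> car pi x ->
  chi_project T (a *: x) = a *: chi_project T x.
Proof.
move=> T0 cx; rewrite /chi_project scaler_sumr; apply: eq_big_seq => t /T0 t0.
by rewrite (actZ hsm) ?emb_unit // !scalerA mulrC.
Qed.

Lemma chi_project_sum T (I : eqType) (r : seq I) (f : I -> pi) :
  {in T, forall t, t != 0} -> {in r, forall i, car pi (f i)} ->
  chi_project T (\sum_(i <- r) f i) = \sum_(i <- r) chi_project T (f i).
Proof.
move=> T0 cf; rewrite /chi_project exchange_big /=; apply: eq_big_seq => t /T0 t0.
by rewrite (act_sum hsm) ?emb_unit // scaler_sumr.
Qed.

Section FixedLevel.
Variables (m : nat) (m0 : (0 < m)%N).
Hypothesis chi_level : trivial_on_units vE chi (2 * m).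
Variables (T : seq E) (hT : transversal (fun t => t != 0) (same_coset vE (2 * m)) T).

Let M0 : (0 < 2 * m)%N. Proof. by rewrite muln_gt0. Qed.
Let T0 : {in T, forall t, t != 0}.
Proof. by case: hT. Qed.
Let cosetR := @same_coset_refl F E vE (2 * m).
Let cosetS := same_coset_sym hE M0.
Let cosetT := same_coset_trans hE M0.

Let chiM t u : t != 0 -> u != 0 -> chi (t * u) = chi t * chi u.
Proof. by case: hchi => _ h _; apply: h. Qed.
Let chi0 t : t != 0 -> chi t != 0.
Proof. by case: hchi => h _ _; apply: h. Qed.

Lemma same_coset_decomp t u : t != 0 -> u != 0 -> same_coset vE (2 * m) t u ->
  exists a k, [/\ a != 0, k != 0, vge vE (2 * m)%N (k - 1) & t = u * (a%:A * k)].
Proof.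
move=> t0 u0 /asboolP[a a0 h]; exists a^-1, (a *: (t / u)); split=> //.
- by rewrite invr_eq0.
- by rewrite scaler_eq0 negb_or a0 mulf_neq0 ?invr_eq0.
- by rewrite mulr_algl scalerA mulVf // scale1r mulrC mulfVK.
Qed.

Lemma chi_coset t u : t != 0 -> u != 0 -> same_coset vE (2 * m) t u -> chi t = chi u.
Proof.
move=> t0 u0 /(same_coset_decomp t0 u0)[a [k [a0 k0 hk ->]]].
have A0 : a%:A != 0 :> E by rewrite scaler_eq0 negb_or a0 oner_neq0.
have uk : is_unit vE k by apply/is_unitP; exact: (near1_unit hvE M0).
by rewrite !chiM ?mulf_neq0 // hchi1 // (chi_level uk hk) !mulr1.
Qed.

(** Scalars act trivially. As E is ramified, level 2m in E matches level m in F, so U_E(2m) embeds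
    into the congruence subgroup fixing x. *)
Lemma act_coset t u x : car pi x -> fixed_level m x ->
  t != 0 -> u != 0 -> same_coset vE (2 * m) t u -> act (emb t) x = act (emb u) x.
Proof.
move=> cx fx t0 u0 /(same_coset_decomp t0 u0)[a [k [a0 k0 hk ->]]].
have A0 : a%:A != 0 :> E by rewrite scaler_eq0 negb_or a0 oner_neq0.
have hk2 : vge vE (m%:Z *+ 2) (k - 1) by apply: vgeW hk; lia.
have vD0 : vge v 0 D by apply: vgeW (vge_val v D); rewrite vD.
have [X hX eX] := quad_embed_near1 hv hE s0 vs vD0 hk2.
have ek : act (emb k) x = x by rewrite /emb eX fx.
have ea : act (emb a%:A) x = x by rewrite /emb (quad_embed_alg hv hE D s0 vs) pi_central.
by rewrite embM (actM hsm) ?emb_unit ?mulf_neq0 // embM (actM hsm) ?emb_unit // ek ea.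
Qed.

(** Multiplication by t permutes the finitely many cosets, so the positive sum of |chi|^2 over them
    is unchanged when multiplied by |chi(t)|^2. *)
Lemma chi_unitary t : t != 0 -> chi t * (chi t)^* = 1.
Proof.
move=> t0; have h1 : transversal (fun t => t != 0) (same_coset vE (2 * m)) (map ( *%R t) T).
  apply: (transversal_map cosetR cosetS cosetT (g := *%R t) (h := *%R t^-1)) => //.
  - by move=> u u0; exact: mulf_neq0.
  - by move=> u u0; apply: mulf_neq0 => //; rewrite invr_eq0.
  - by move=> u w _ _; rewrite -{1}[w](mulVKf t0) same_coset_mul.
  - by move=> u u0; rewrite mulKf //; exact: cosetR.
have := transversal_sum cosetR cosetS cosetT (f := fun u => `|chi u| ^+ 2) _ h1 hT.
rewrite big_map => e.
have {}e : `|chi t| ^+ 2 * (\sum_(u <- T) `|chi u| ^+ 2) = \sum_(u <- T) `|chi u| ^+ 2.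
  rewrite -[RHS]e; last by move=> u w u0 w0 uw; rewrite (chi_coset u0 w0 uw).
  by rewrite big_distrr /=; apply: eq_big_seq => u /T0 u0; rewrite chiM // normrM exprMn.
have pos : \sum_(u <- T) `|chi u| ^+ 2 != 0.
  case: hT => _ _ cov; have /hasP[u uT _] := cov 1 (oner_neq0 _).
  have Tu : uniq T by exact: (transversal_uniq cosetR hT).
  rewrite (bigD1_seq u) //= gt_eqF //; apply: ltr_pwDl.
    by rewrite exprn_gt0 // normr_gt0 chi0 // T0.
  by apply: sumr_ge0 => w _; rewrite exprn_ge0.
by rewrite -normCK; apply: (mulIf pos); rewrite mul1r.
Qed.

Let integrand (x y : pi) (t : E) : R[i] := ip (act (emb t) x) y * chi t.

Lemma integrand_coset x y t u : car pi x -> fixed_level m x ->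
  t != 0 -> u != 0 -> same_coset vE (2 * m) t u -> integrand x y t = integrand x y u.
Proof.
by move=> cx fx t0 u0 tu; rewrite /integrand (act_coset cx fx t0 u0 tu) (chi_coset t0 u0 tu).
Qed.

(** Expanding the right-hand projection over u, invariance moves u to the left as u^-1. Replacing
    u^-1 t by t then shows that all |T| inner sums are equal. *)
Lemma ip_chi_project x y : car pi x -> car pi y -> fixed_level m x ->
  ip (chi_project T x) (chi_project T y) =
  (size T)%:R * \sum_(t <- T) integrand x y t.
Proof.
move=> cx cy fx; have ce t z : t != 0 -> car pi z -> car pi (act (emb t) z).
  by move=> t0; apply: (car_act hsm); exact: emb_unit.
rewrite {2}/chi_project (ip_sumr hsm hip); first last.
- by move=> t /T0 t0; apply: (carZ hsm); exact: ce.
- exact: car_chi_project.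
rewrite (eq_big_seq (fun=> \sum_(t <- T) integrand x y t)); last first.
  move=> u /T0 u0; have uV0 : u^-1 != 0 by rewrite invr_eq0.
  have h1 : transversal (fun t => t != 0) (same_coset vE (2 * m)) (map ( *%R u^-1) T).
    apply: (transversal_map cosetR cosetS cosetT (g := *%R u^-1) (h := *%R u)) => //.
    - by move=> w w0; exact: mulf_neq0.
    - by move=> w w0; exact: mulf_neq0.
    - by move=> w z _ _; rewrite -{1}[z](mulKf u0) same_coset_mul.
    - by move=> w w0; rewrite mulVKf //; exact: cosetR.
  rewrite -(transversal_sum cosetR cosetS cosetT (f := integrand x y) _ h1 hT); last first.
    by move=> t w t0 w0; exact: integrand_coset.
  rewrite big_map /chi_project (ip_suml hsm hip); first last.
  - by move=> t /T0 t0; apply: (carZ hsm); exact: ce.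
  - by apply: (carZ hsm); exact: ce.
  apply: eq_big_seq => t /T0 t0.
  have [cet ceu] := (ce _ _ t0 cx, ce _ _ u0 cy).
  rewrite (ipZl hsm hip) ?(ipZr hsm hip) //; last exact: (carZ hsm).
  rewrite /integrand embM (actM hsm) ?emb_unit // chiM //.
  have -> : ip (act (emb t) x) (act (emb u) y) = ip (act (emb u^-1) (act (emb t) x)) y.
    rewrite -(ip_act hip (emb_unit uV0)) //.
    rewrite -[act (emb u^-1) (act (emb u) y)](actM hsm) ?emb_unit //.
    by rewrite -embM mulVf // -[1]scale1r /emb (quad_embed_alg hv hE D s0 vs) (act1 hsm).
  have -> : chi u^-1 = (chi u)^*.
    apply: (mulfI (chi0 u0)); rewrite chi_unitary // -chiM // mulfV //.
    by rewrite -[1]scale1r hchi1 ?oner_neq0.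
  by ring.
by rewrite big_const_seq count_predT iter_addr_0 mulr_natl.
Qed.

End FixedLevel.

(* Vectors fixed by a common congruence subgroup only see finitely many cosets of
   the compact group [F^* \ E^*]. *)
Lemma period_gram (xs : seq pi) : {in xs, forall x, car pi x} ->
  exists (kappa : R[i]) (T : seq E), {in T, forall t, t != 0} /\
    {in xs &, forall x y, period mu ip s D chi x y =
      kappa * ip (chi_project T x) (chi_project T y)}.
Proof.
move=> cxs; have [_ _ [k hk]] := hchi.
have [m hm fx] := common_level k.+1 cxs.
have m0 : (0 < m)%N by lia.
have M0 : (0 < 2 * m)%N by lia.
have chi_level : trivial_on_units vE chi (2 * m).
  by move=> t ut ht; apply: hk => //; apply: vgeW ht; lia.
have [T hT] := coset_transversal hv hE M0 varpi0 vvarpi hdig sdig s0 vs.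
have [w _ hw] := coset_measure hE M0 hmu.
have T0 : {in T, forall t, t != 0} by case: hT.
have N0 : (size T)%:R != 0 :> R[i].
  rewrite pnatr_eq0 size_eq0; case: hT => _ _ cov.
  by apply: contraTneq (cov 1 (oner_neq0 _)) => ->.
(* The integral weighs each coset by w, while the inner product of the unnormalized projections
   counts each term |T| times. *)
exists (Complex w 0 / (size T)%:R), T; split=> // x y xX yX.
rewrite (ip_chi_project m0 chi_level hT (cxs _ xX) (cxs _ yX) (fx _ xX)).
rewrite mulrA mulfVK //; apply: (complex_integral_cosets hE M0 hT hw) => t u t0 u0 tu.
by apply: (integrand_coset m0 chi_level) => //; [exact: cxs | exact: fx].
Qed.

End PeriodGram.

(** The words [for a single x] are rendered by two conditions: the diagonal period is nonzero at x
    and zero at every other class. *)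
Theorem proposition1p1 (R : realType)
  (* the p-adic field F and the additive character psi *)
  (F : fieldType) (v : F -> int) (p q : nat)
  (hF : padic_field v p q) (hp : p <> 2%N)
  (varpi : F) (hvarpi0 : varpi != 0) (hvarpi : v varpi = 1)
  (psi : F -> R[i]) (hpsi : additive_character v psi)
  (hpsi0 : trivial_on_ideal v psi 0) (hpsi1 : ~ trivial_on_ideal v psi (-1))
  (* L, theta and the representation pi *)
  (L : fieldExtType F) (vL : L -> int) (hL : ramified_quadratic v vL)
  (theta : L -> R[i]) (htheta : mult_character vL theta)
  (htheta1 : forall a : F, a != 0 -> theta a%:A = 1)
  (n : nat) (hn : (1 <= n)%N) (hc : conductor vL theta = (2 * n)%N)
  (alpha : L) (halpha0 : alpha != 0) (halpha_tr : trE alpha = 0)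
  (halpha : forall u : L, vge vL n u ->
     theta (1 + u) = psi_ext psi (alpha * u))
  (D' : F) (hD' : D'%:A = alpha ^- 2 * (varpi ^- (2 * n))%:A :> L)
  (pi : gl2rep (R[i] : numClosedFieldType) F)
  (hpi : pi = cInd v psi theta n alpha (alpha^-1 * (varpi ^- n)%:A) D')
  (ip : pi -> pi -> R[i]) (hip : invariant_inner_product ip)
  (phi0 : pi) (hphi0 : car pi phi0) (hphi0_norm : ip phi0 phi0 = 1)
  (hphi0_J : forall j z,
     theta_tilde v psi theta n alpha (alpha^-1 * (varpi ^- n)%:A) D' j z ->
     act j phi0 = z *: phi0)
  (phinew : pi) (hphinew : car pi phinew) (hphinew_norm : ip phinew phinew = 1)
  (hphinew_K1 : fixed_by_K1 v (rep_conductor v pi) phinew)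
  (* E, chi and the period *)
  (E : fieldExtType F) (vE : E -> int) (hE : ramified_quadratic v vE)
  (hEL : exists f : 'AHom(L, E), bijective f)
  (D : F) (hD0 : D != 0) (hD : v D = 1)
  (sqrtD : E) (hsqrtD : sqrtD ^+ 2 = D%:A)
  (chi : E -> R[i]) (hchi : mult_character vE chi)
  (hchi1 : forall a : F, a != 0 -> chi a%:A = 1)
  (pi_chi : gl2rep (R[i] : numClosedFieldType) F)
  (hpi_chi : langlands_induced v q vE psi pi_chi chi)
  (hc_chi : (rep_conductor v pi_chi <= rep_conductor v pi)%N)
  (heps : base_change_epsilon v q vL vE psi pi chi = 1)
  (mu : {measure set (EmodF vE) -> \bar R}) (hmu : normalized_haar mu) :
  let pairing := period mu ip sqrtD D chi in
  let phi_tilde := act (mx22 (varpi ^+ n) 0 0 1) phinew in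
  let phi := fun x : F => act (mx22 x 0 0 1) phi0 in
  let same_class := fun x y : F => vge v (uphalf n) (x - y) in
  forall x : F, is_unit v x ->
    pairing (phi x) (phi x) != 0 ->
    (forall y : F, is_unit v y -> ~~ same_class y x ->
       pairing (phi y) (phi y) = 0) ->
    (forall y y' : F, is_unit v y -> is_unit v y' -> ~~ same_class y y' ->
       pairing (phi y) (phi y') = 0) /\
    pairing phi_tilde phi_tilde =
      ((q%:R - 1) * q%:R ^+ (uphalf n - 1))^-1 * pairing (phi x) (phi x).
Proof.
move=> pairing phi_tilde phi same_class x ux px hzero.
have [hv _ ch [pp vp] [digits hdig sdig]] := hF.
have two_u := two_unit hv ch pp hp vp.
have [_ psiD _] := hpsi.
have s0 := sqrt_neq0 hvarpi0 n halpha0; have s2 := sqrt_sqr hD'.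
have D'0 := D'_neq0 hvarpi0 halpha0 hD'.
have vs := sqrt_uniformizer hv two_u hvarpi0 hvarpi hpsi0 hpsi1 hL htheta hn hc
  halpha0 halpha_tr halpha hD'.
have vD' := val_D' hv two_u hvarpi0 hvarpi hpsi0 hpsi1 hL htheta hn hc
  halpha0 halpha_tr halpha hD'.
have alphaE := alpha_sqrt hvarpi0 halpha0 hD'.
have [t0 vt] := val_sqrt hE hD0 hD hsqrtD.
subst pi.
set V := cInd v psi theta n alpha (alpha^-1 * (varpi ^- n)%:A) D' in ip hip
  phi0 hphi0 hphi0_norm hphi0_J phinew hphinew hphinew_norm hphinew_K1 heps
  pairing phi_tilde phi px hzero *.
have hsm : smooth_rep v V by exact: smooth_cInd.
have central (a : F) (f : V) : a != 0 -> car V f -> act a%:M f = f.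
  move=> a0 cf; apply: funext => h /=.
  by rewrite scalar_mxC (cInd_scalar hv hpsi0 hL htheta1 s0 vs).
have gram := period_gram hv hvarpi0 hvarpi hdig sdig hE t0 vt hsqrtD hD hchi hchi1
  hsm central hip hmu.
have ne0 y : is_unit v y -> y != 0 by move=> /is_unitP[].
have cphi y : is_unit v y -> car V (phi y) by move=> /ne0; exact: (car_twist hv hphi0).
split.
  move=> y y' uy uy' nyy'.
  (* [phi x] is included only to certify that kappa is nonzero. *)
  have cxs : {in [:: phi x; phi y; phi y'], forall f, car V f}.
    by move=> f; rewrite !inE => /or3P[] /eqP ->; exact: cphi.
  have [kappa [T [T0 hT]]] := gram _ cxs.
  have cP z : is_unit v z -> car V (chi_project D sqrtD chi T (phi z)).
    by move=> uz; apply: (car_chi_project hv hE t0 vt hsqrtD _ hsm T0); exact: cphi.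
  have k0 : kappa != 0.
    apply: contraNneq px => k0.
    by rewrite /pairing hT ?k0 ?mul0r // ?inE eqxx.
  have P0 z : is_unit v z -> phi z \in [:: phi x; phi y; phi y'] ->
      ~~ same_class z x -> chi_project D sqrtD chi T (phi z) = 0.
    move=> uz zin nzx; apply: (ip_definite hip (cP _ uz)).
    have /eqP := hzero _ uz nzx; rewrite /pairing hT // mulf_eq0 (negPf k0) /=.
    by move/eqP.
  rewrite /pairing hT ?inE ?eqxx ?orbT //.
  (* At least one of y, y' lies outside the class of x, and its projection vanishes. *)
  have [yx|nyx] := boolP (same_class y x); last first.
    by rewrite P0 ?inE ?eqxx ?orbT // (ip0l hsm hip) ?mulr0 //; exact: cP.
  have ny'x : ~~ same_class y' x.
    by apply: contra nyy' => y'x; apply: (cong_trans hv yx); rewrite cong_sym.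
  by rewrite [X in ip _ X]P0 ?inE ?eqxx ?orbT // (ip0r hsm hip) ?mulr0 //; exact: cP.
have m0 : (0 < uphalf n)%N by rewrite uphalf_gt0.
have [tr htr str] := unit_transversal hv hvarpi0 hvarpi hdig sdig m0.
have [tru _ trcov] := htr.
(* x need not itself be in the list of representatives; x0 stands for its class and gives the same
   translate. *)
have /hasP[x0 x0tr xx0] := trcov x ux.
have ux0 := tru _ x0tr.
have tr0 : (0 < size tr)%N by case: (tr) x0tr.
have [c ec hcN] := newvector_expansion hv hvarpi0 hvarpi hn hpsi0 hpsi1 psiD hL htheta1
  s0 vs s2 D'0 vD' alphaE hip hphi0 hphi0_norm hphi0_J htr tr0 hphinew hphinew_norm hphinew_K1.
have ex0 : phi x = phi x0.
  exact: (twist_cong hv hpsi0 hL htheta1 s0 vs D'0 alphaE hphi0 hphi0_J ux ux0 xx0).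
have ctr : {in tr, forall y, car V (phi y)} by move=> y /tru; exact: cphi.
have cS : car V (\sum_(y <- tr) phi y) by exact: (car_twist_sum hv hphi0 htr).
have ec' : phi_tilde = c *: \sum_(y <- tr) phi y by [].
have ctilde : car V phi_tilde by rewrite ec'; exact: (carZ hsm).
(* One list for the newform and all translates, so that the same kappa and [T] serve for every
   comparison. *)
have cxs : {in phi_tilde :: map phi tr, forall f, car V f}.
  by move=> f; rewrite inE => /orP[/eqP->//|/mapP[y ytr ->]]; exact: ctr.
have [kappa [T [T0 hT]]] := gram _ cxs.
have trin y : y \in tr -> phi y \in phi_tilde :: map phi tr.
  by move=> ytr; rewrite inE map_f ?orbT.
have cP y : y \in tr -> car V (chi_project D sqrtD chi T (phi y)).
  by move=> ytr; apply: (car_chi_project hv hE t0 vt hsqrtD _ hsm T0); exact: ctr.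
have k0 : kappa != 0.
  by apply: contraNneq px => k0; rewrite ex0 /pairing hT ?trin // k0 mul0r.
have PS : chi_project D sqrtD chi T (\sum_(y <- tr) phi y) =
    chi_project D sqrtD chi T (phi x0).
  rewrite (chi_project_sum hv hE t0 vt hsqrtD _ hsm T0 ctr).
  rewrite (bigD1_seq x0 x0tr (transversal_uniq (fun y _ => cong_refl v _ y) htr)) /=.
  rewrite big_seq_cond big1 ?addr0 // => y /andP[ytr nyx0].
  apply: (ip_definite hip (cP _ ytr)); have uy := tru _ ytr.
  have nyx : ~~ same_class y x.
    apply: contra nyx0 => yx; apply/eqP.
    apply: (transversal_inj (fun y z _ _ => etrans (cong_sym hv _ _ _)) htr) => //.
    exact: (cong_trans hv yx xx0).
  have /eqP := hzero _ uy nyx; rewrite /pairing hT ?trin // mulf_eq0 (negPf k0) /=.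
  by move/eqP.
have -> : pairing phi_tilde phi_tilde = (size tr)%:R^-1 * pairing (phi x) (phi x).
  rewrite -hcN ex0 /pairing !hT ?trin ?mem_head // ec'.
  rewrite (chi_projectZ hv hE t0 vt hsqrtD _ hsm c T0 cS) PS.
  have cPx0 := cP _ x0tr.
  rewrite (ipZl hsm hip) ?(ipZr hsm hip) //; last exact: (carZ hsm).
  by ring.
rewrite str natrM natrX subn1; congr (_^-1 * _); congr (_ * _).
(* Positivity of q turns the truncated predecessor in the unit count into q - 1. *)
have q0 : (0 < q)%N.
  by rewrite -sdig; case: hdig => _ _ /(_ 0 (vge0 v 0)); case: (digits).
by rewrite -subn1 natrB.
Qed.
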